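(* Let $(R,\mathfrak{m})$ be a commutative Noetherian local ring, let $N$ be a non-zero finitely generated $R$-module, and let $R^*$ and $N^*$ denote the $\mathfrak{m}$-adic completions of $R$ and $N$. Let $\mathfrak{p}\in \operatorname{Supp}(N)$ be a prime ideal with $\dim R/\mathfrak{p}=1$. Then the $\mathfrak{p}$-adic topology on $N$ is equivalent to the $\mathfrak{p}$-symbolic topology on $N$ if and only if for every $z\in \operatorname{Ass}_{R^*}N^*$ there exists $\mathfrak{q}\in \operatorname{Supp}_{R^*}(N^* )$ such that $z\subseteq \mathfrak{q}$ and $\mathfrak{q}\cap R=\mathfrak{p}$.
   Context: For an $R$-module $L$, $\operatorname{mAss}_R L$ denotes the set of minimal elements (with respect to inclusion) of $\operatorname{Ass}_R L$. For an ideal $I$ of $R$ and a natural number $n$, the $n$th symbolic power of $I$ with respect to $N$ is $$(IN)^{(n)}=\{x\in N : sx\in I^nN \text{ for some } s\in R\setminus\textstyle\bigcup_{\mathfrak{p}\in \operatorname{mAss}_R N/IN}\mathfrak{p}\},$$ equivalently the intersection of those primary components of $I^nN$ which correspond to the minimal primes of $\operatorname{Ass}_R N/IN$. The $I$-adic topology on $N$ is induced by the filtration $\{I^nN\}_{n\ge 0}$ and the $I$-symbolic topology on $N$ by the filtration $\{(IN)^{(n)}\}_{n\ge 0}$. One always has $I^nN\subseteq (IN)^{(n)}$; the two topologies are said to be equivalent if for every natural number $n$ there is a natural number $m$ such that $(IN)^{(m)}\subseteq I^nN$. $\mathfrak{q}\cap R$ denotes the contraction of $\mathfrak{q}$ along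 the natural map $R\to R^*$. *)

(* Defs.v *)
From HB Require Import structures.
#[warning="-notation-overridden"]
From mathcomp Require Import all_boot all_order all_algebra.
From mathcomp Require Import ring_quotient generic_quotient.
From mathcomp Require Import boolp classical_sets functions.

Set Implicit Arguments.
Unset Strict Implicit.
Unset Printing Implicit Defensive.

Import GRing.Theory.
Local Open Scope ring_scope.
Local Open Scope quotient_scope.

(* Ideals and submodules are boolean predicates, as in ring_quotient; since   *)
(* boolp provides `[< P >] : bool for every proposition P, this is no         *)
(* restriction. Recall that idealr (hence prime_idealr) means a PROPER ideal. *)

Section FiniteGeneration.
Variables (R : comNzRingType) (N : lmodType R).

Definition generated_by (s : seq N) (L : {pred N}) : Prop :=
  forall x, x \in L <->
    exists a : 'I_(size s) -> R, x = \sum_(i < size s) a i *: s`_i.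

Definition fin_generated : Prop := exists s : seq N, generated_by s predT.

Definition noetherian_module : Prop :=
  forall L : submodClosed N, exists s : seq N, generated_by s L.

End FiniteGeneration.

Arguments fin_generated {R} N.
Arguments noetherian_module {R} N.

Definition noetherian_ring (R : comNzRingType) : Prop :=
  noetherian_module (R^o : lmodType R).

Definition maximal_ideal (R : comNzRingType) (m : idealr R) : Prop :=
  forall J : idealr R, {subset m <= J} -> {subset J <= m}.

Definition local_ring (R : comNzRingType) (m : idealr R) : Prop :=
  maximal_ideal m /\ forall J : idealr R, maximal_ideal J -> J =i m.

Definition prime_chain (A : comNzRingType) (d : nat)
    (c : nat -> prime_idealr A) : Prop :=
  forall i, (i < d)%N ->
    {subset c i <= c i.+1} /\ ~ {subset c i.+1 <= c i}.

(* has_krull_dim A d : the supremum of the lengths of the chains of primes    *)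
(* c 0 < ... < c e of A is d (the values of c beyond index e are irrelevant). *)
Definition has_krull_dim (A : comNzRingType) (d : nat) : Prop :=
  (exists c, @prime_chain A d c) /\
  (forall e c, @prime_chain A e c -> (e <= d)%N).

Section IdealProducts.
Variable R : comNzRingType.

Definition smul (N : lmodType R) (I : {pred R}) (L : {pred N}) : {pred N} :=
  fun x => `[< exists s : seq (R * N),
    (forall u, u \in s -> u.1 \in I /\ u.2 \in L) /\
    x = \sum_(u <- s) u.1 *: u.2 >].

Fixpoint idealX (I : {pred R}) (n : nat) : {pred R} :=
  if n is n'.+1 then smul (N := R^o) I (idealX I n') else predT.

Definition imod (N : lmodType R) (I : {pred R}) : {pred N} := smul I predT.
Arguments imod N I _ : clear implicits.

Lemma imod_closed (N : lmodType R) (I : {pred R}) : submod_closed (imod N I).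
Proof.
split; first by apply/asboolP; exists [::]; split=> //; rewrite big_nil.
move=> a x y /asboolP[s [sP ->]] /asboolP[t [tP ->]]; apply/asboolP.
exists ([seq (u.1, a *: u.2) | u <- s] ++ t); split=> [u|].
  rewrite mem_cat => /orP[/mapP[v vs ->]|/tP//].
  by have [] := sP _ vs.
rewrite big_cat big_map scaler_sumr; congr (_ + _).
by apply: eq_bigr => u _; rewrite /= !scalerA mulrC.
Qed.

HB.instance Definition _ (N : lmodType R) (I : {pred R}) :=
  GRing.isSubmodClosed.Build R N (imod N I) (imod_closed N I).

Lemma imodR_scale (N : lmodType R) (I : {pred R}) (a : R^o) (x : N) :
  a \in imod R^o I -> (a : R) *: x \in imod N I.
Proof.
move=> /asboolP[s [sP ->]]; rewrite scaler_suml big_seq rpred_sum // => u us.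
apply/asboolP; exists [:: (u.1, (u.2 : R) *: x)]; split=> [v|].
  by rewrite inE => /eqP->; have [] := sP _ us.
by rewrite big_seq1 /= scalerA.
Qed.

Lemma idealX1_proper (I : idealr R) : (1 : R^o) \notin imod R^o (idealX I 1).
Proof.
have I1 (x : R) : x \in idealX I 1 -> x \in I.
  move=> /asboolP[s [sP ->]]; rewrite big_seq rpred_sum // => u us.
  by rewrite /GRing.scale /= mulrC; apply: idealMr; have [] := sP _ us.
apply/negP => /asboolP[s [sP E]]; suff : (1 : R) \in I by rewrite idealr1.
rewrite E big_seq rpred_sum // => u us.
by rewrite /GRing.scale /= mulrC; apply/idealMr/I1; have [] := sP _ us.
Qed.

End IdealProducts.

Arguments imod {R} N I _.

Section QuotientModule.
Variables (R : comNzRingType) (N : lmodType R) (L : submodClosed N).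

(* submodClosed is declared over semirings, hence does not inherit from       *)
(* zmodClosed, which the quotient construction expects.                       *)
Definition zmod_of_submod : {pred N} := L.

HB.instance Definition _ := GRing.isZmodClosed.Build N zmod_of_submod
  (GRing.submod_closedB (submodClosedP L)).

Definition quotmod : Type := Quotient.quot zmod_of_submod.

HB.instance Definition _ := GRing.Zmodule.on quotmod.
HB.instance Definition _ := EqQuotient.on quotmod.

Definition quotmod_scale (a : R) (x : quotmod) : quotmod :=
  \pi_quotmod (a *: repr x).

Lemma quotmod_piE (x y : N) :
  (\pi_quotmod x = \pi_quotmod y) <-> (x - y \in L).
Proof.
have E : (x - y \in L) = (\pi_quotmod x == \pi_quotmod y).
  exact: (Quotient.idealrBE zmod_of_submod).
by rewrite E; split=> /eqP.
Qed.

Lemma quotmod_piD (x y : N) :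
  \pi_quotmod (x + y) = \pi_quotmod x + \pi_quotmod y.
Proof. exact: (Quotient.pi_add zmod_of_submod). Qed.

Lemma quotmod_piZ (a : R) (x : N) :
  quotmod_scale a (\pi_quotmod x) = \pi_quotmod (a *: x).
Proof.
apply/quotmod_piE; rewrite -scalerBr rpredZ //.
by apply/(quotmod_piE _ _).1; rewrite reprK.
Qed.

Lemma quotmod_scalerA a b v :
  quotmod_scale a (quotmod_scale b v) = quotmod_scale (a * b) v.
Proof.
rewrite -[v]reprK [quotmod_scale b _]quotmod_piZ !quotmod_piZ scalerA//.
Qed.

Lemma quotmod_scale1r : left_id 1 quotmod_scale.
Proof. by move=> v; rewrite -[v]reprK quotmod_piZ scale1r. Qed.

Lemma quotmod_scalerDr : right_distributive quotmod_scale +%R.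
Proof.
move=> a u v; rewrite -[u]reprK -[v]reprK -quotmod_piD !quotmod_piZ.
by rewrite scalerDr quotmod_piD.
Qed.

Lemma quotmod_scalerDl v : {morph quotmod_scale^~ v : a b / a + b}.
Proof.
by move=> a b; rewrite -[v]reprK !quotmod_piZ scalerDl quotmod_piD.
Qed.

HB.instance Definition _ := GRing.Zmodule_isLmodule.Build R quotmod
  quotmod_scalerA quotmod_scale1r quotmod_scalerDr quotmod_scalerDl.

End QuotientModule.

Section AssSupp.
Variables (R : comNzRingType) (N : lmodType R).

Definition Ass (p : prime_idealr R) : Prop :=
  exists x : N, forall a, (a \in p) <-> (a *: x = 0).

Definition mAss (p : prime_idealr R) : Prop :=
  Ass p /\ forall q, Ass q -> {subset q <= p} -> {subset p <= q}.

(* Equality of the fractions f.1 / f.2 and g.1 / g.2 in the localization N_p. *)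
Definition loc_eq (p : prime_idealr R) (f g : N * R) : Prop :=
  exists2 u : R, u \notin p & u *: (g.2 *: f.1 - f.2 *: g.1) = 0.

(* The localization N_p is nonzero. *)
Definition Supp (p : prime_idealr R) : Prop :=
  exists2 f : N * R, f.2 \notin p & ~ loc_eq p f (0, 1).

End AssSupp.

Arguments Ass {R} N p.
Arguments mAss {R} N p.
Arguments Supp {R} N p.

Section SymbolicTopology.
Variables (R : comNzRingType) (N : lmodType R) (I : {pred R}).

Definition symbolic_power (n : nat) (x : N) : Prop :=
  exists2 s : R,
    (forall q, mAss (quotmod (imod N I)) q -> s \notin q) &
    s *: x \in imod N (idealX I n).

Definition adic_equiv_symbolic : Prop :=
  forall n, exists k, forall x, symbolic_power k x -> x \in imod N (idealX I n).

End SymbolicTopology.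

Arguments symbolic_power {R} N I n x.
Arguments adic_equiv_symbolic {R} N I.

(* Completion: Cauchy sequences for the filtration I^k N, modulo the          *)
(* sequences converging to 0.                                                 *)
Section CauchySequences.
Variables (R : comNzRingType) (I : {pred R}) (N : lmodType R).

Definition cauchy : {pred nat -> N} := fun x =>
  `[< forall k, exists n0, forall i j, (n0 <= i)%N -> (n0 <= j)%N ->
        x i - x j \in imod N (idealX I k) >].

Definition null_seq (x : nat -> N) : Prop :=
  forall k, exists n0, forall i, (n0 <= i)%N -> x i \in imod N (idealX I k).

Lemma cauchy_zmod : zmod_closed cauchy.
Proof.
split.
  by apply/asboolP => k; exists 0%N => i j _ _; rewrite subr0 rpred0.
move=> x y /asboolP xC /asboolP yC; apply/asboolP => k.
have [n1 H1] := xC k; have [n2 H2] := yC k.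
exists (maxn n1 n2) => i j; rewrite !geq_max => /andP[i1 i2] /andP[j1 j2].
have -> : (x - y) i - (x - y) j = (x i - x j) - (y i - y j).
  rewrite [LHS](_ : _ = (x i - y i) - (x j - y j)) //.
  by rewrite !opprD !opprK addrACA.
by rewrite rpredB ?H1 ?H2.
Qed.

HB.instance Definition _ := GRing.isZmodClosed.Build (nat -> N) cauchy
  cauchy_zmod.

Lemma null_seqD x y : null_seq x -> null_seq y ->
  null_seq (fun i => x i + y i).
Proof.
move=> xC yC k; have [n1 H1] := xC k; have [n2 H2] := yC k.
exists (maxn n1 n2) => i; rewrite !geq_max => /andP[i1 i2].
by rewrite rpredD ?H1 ?H2.
Qed.

End CauchySequences.

Arguments cauchy {R} I N _.

Section CauchyAction.
Variables (R : comNzRingType) (I : {pred R}) (N : lmodType R).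

Lemma cauchy_scale (a : nat -> R) (x : nat -> N) :
  (a : nat -> R^o) \in cauchy I R^o -> x \in cauchy I N ->
  (fun i => a i *: x i) \in cauchy I N.
Proof.
move=> /asboolP aC /asboolP xC; apply/asboolP => k.
have [n1 H1] := aC k; have [n2 H2] := xC k.
exists (maxn n1 n2) => i j; rewrite !geq_max => /andP[i1 i2] /andP[j1 j2].
have -> : a i *: x i - a j *: x j = a i *: (x i - x j) + (a i - a j) *: x j.
  by rewrite scalerBr scalerBl addrA addrNK.
by apply: rpredD; [apply: rpredZ; exact: H2|apply: imodR_scale; exact: H1].
Qed.

Lemma null_scale (a : nat -> R) (x : nat -> N) :
  null_seq I x -> null_seq I (fun i => a i *: x i).
Proof.
by move=> xC k; have [n0 H] := xC k; exists n0 => i i0; rewrite rpredZ ?H.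
Qed.

Lemma null_scalel (a : nat -> R) (x : nat -> N) :
  null_seq I (a : nat -> R^o) -> null_seq I (fun i => a i *: x i).
Proof.
by move=> aC k; have [n0 H] := aC k; exists n0 => i i0; rewrite imodR_scale ?H.
Qed.

End CauchyAction.

Section CauchyRing.
Variables (R : comNzRingType) (I : {pred R}).

Definition cauchyR : {pred nat -> R} := cauchy I R^o.

Lemma cauchyR_subring : subring_closed cauchyR.
Proof.
have [C0 CB] := cauchy_zmod I (R^o : lmodType R); split.
- by apply/asboolP => k; exists 0%N => i j _ _; rewrite subrr rpred0.
- exact: CB.
- by move=> x y xC yC; exact: (@cauchy_scale R I R^o x y xC yC).
Qed.

HB.instance Definition _ := GRing.isSubringClosed.Build (nat -> R) cauchyR
  cauchyR_subring.

Definition cauchy_ring : Type := {x : nat -> R | x \in cauchyR}.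
HB.instance Definition _ := SubChoice.on cauchy_ring.
HB.instance Definition _ :=
  [SubChoice_isSubComNzRing of cauchy_ring by <:].

Definition null_ideal : {pred cauchy_ring} :=
  fun x => `[< null_seq I (val x : nat -> R^o) >].

End CauchyRing.

Section CauchyModule.
Variables (R : comNzRingType) (I : {pred R}) (N : lmodType R).

Definition cauchy_module : Type := {x : nat -> N | x \in cauchy I N}.
HB.instance Definition _ := SubChoice.on cauchy_module.
HB.instance Definition _ := [SubChoice_isSubZmodule of cauchy_module by <:].

Definition cauchy_module_scale (a : cauchy_ring I) (x : cauchy_module) :
    cauchy_module :=
  exist _ (fun i => val a i *: val x i) (cauchy_scale (valP a) (valP x)).

Lemma cauchy_module_scalerA a b v :
  cauchy_module_scale a (cauchy_module_scale b v)
    = cauchy_module_scale (a * b) v.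
Proof. by apply/val_inj/funext => i /=; rewrite scalerA. Qed.

Lemma cauchy_module_scale1r : left_id 1 cauchy_module_scale.
Proof. by move=> v; apply/val_inj/funext => i /=; rewrite scale1r. Qed.

Lemma cauchy_module_scalerDr : right_distributive cauchy_module_scale +%R.
Proof. by move=> a u v; apply/val_inj/funext => i /=; rewrite scalerDr. Qed.

Lemma cauchy_module_scalerDl v : {morph cauchy_module_scale^~ v : a b / a + b}.
Proof. by move=> a b; apply/val_inj/funext => i /=; rewrite scalerDl. Qed.

HB.instance Definition _ :=
  GRing.Zmodule_isLmodule.Build (cauchy_ring I) cauchy_module
  cauchy_module_scalerA cauchy_module_scale1r
  cauchy_module_scalerDr cauchy_module_scalerDl.

Definition null_submod : {pred cauchy_module} :=
  fun x => `[< null_seq I (val x) >].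

Lemma null_submod_closed : submod_closed null_submod.
Proof.
split; first by apply/asboolP => k; exists 0%N => i _; rewrite rpred0.
move=> a x y /asboolP xC /asboolP yC; apply/asboolP.
exact/null_seqD/yC/null_scale.
Qed.

HB.instance Definition _ :=
  GRing.isSubmodClosed.Build (cauchy_ring I) cauchy_module null_submod
  null_submod_closed.

End CauchyModule.

Section Completion.
Variables (R : comNzRingType) (I : idealr R).

Lemma null_ideal_closed : idealr_closed (@null_ideal R I).
Proof.
split; first by apply/asboolP => k; exists 0%N => i _; rewrite rpred0.
  apply/negP => /asboolP /(_ 1%N)[n0 /(_ n0 (leqnn _))].
  by apply/negP; exact: idealX1_proper.
move=> a x y /asboolP xC /asboolP yC; apply/asboolP.
by apply: null_seqD yC; exact: (@null_scale R I R^o (val a)).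
Qed.

HB.instance Definition _ :=
  isIdealr.Build (cauchy_ring I) (@null_ideal R I) null_ideal_closed.

Definition completion_ring : comNzRingType := {ideal_quot (@null_ideal R I)}.

Lemma cst_cauchy (a : R) : (fun=> a) \in cauchyR I.
Proof. by apply/asboolP => k; exists 0%N => i j _ _; rewrite subrr rpred0. Qed.

Definition completion_map (a : R) : completion_ring :=
  \pi_({ideal_quot (@null_ideal R I)}) (exist _ (fun=> a) (cst_cauchy a)).

Lemma completion_map_zmod : zmod_morphism completion_map.
Proof.
move=> a b; rewrite /completion_map -raddfB; congr (\pi _).
exact: val_inj.
Qed.

HB.instance Definition _ :=
  GRing.isZmodMorphism.Build R completion_ring completion_map
  completion_map_zmod.

Lemma completion_map_monoid : monoid_morphism completion_map.
Proof.
split=> [|a b]; rewrite /completion_map.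
  rewrite -(rmorph1 (\pi_{ideal_quot (@null_ideal R I)})).
  by congr (\pi _); exact: val_inj.
by rewrite -rmorphM; congr (\pi _); exact: val_inj.
Qed.

HB.instance Definition _ :=
  GRing.isMonoidMorphism.Build R completion_ring completion_map
  completion_map_monoid.

Variable N : lmodType R.

Definition completion_module : Type := quotmod (@null_submod R I N).
HB.instance Definition _ := GRing.Zmodule.on completion_module.

Definition completion_scale (a : completion_ring) (x : completion_module) :
    completion_module :=
  (repr (a : {ideal_quot (@null_ideal R I)})) *: (x : quotmod _).

Lemma completion_scaleE (a : cauchy_ring I) (x : completion_module) :
  completion_scale (\pi_({ideal_quot (@null_ideal R I)}) a) x
    = a *: (x : quotmod _).
Proof.
apply/eqP; rewrite -subr_eq0 -scalerBl; apply/eqP.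
set d := _ - a; have /asboolP dn : d \in @null_ideal R I.
  by rewrite Quotient.idealrBE reprK.
rewrite -[x]reprK [LHS]quotmod_piZ.
have -> : 0 = \pi_(quotmod (@null_submod R I N)) 0.
  by rewrite -[LHS](scale0r (\pi_(quotmod (@null_submod R I N)) 0))
             [LHS]quotmod_piZ scale0r.
apply/quotmod_piE; rewrite subr0; apply/asboolP.
exact: (@null_scalel R I N (val d)).
Qed.

Lemma completion_piP (a : completion_ring) :
  exists b, a = \pi_({ideal_quot (@null_ideal R I)}) b.
Proof.
by exists (repr (a : {ideal_quot (@null_ideal R I)})); rewrite reprK.
Qed.

Lemma completion_scalerA a b v :
  completion_scale a (completion_scale b v) = completion_scale (a * b) v.
Proof.
have [x ->] := completion_piP a; have [y ->] := completion_piP b.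
rewrite -(rmorphM (\pi_({ideal_quot (@null_ideal R I)}))).
by rewrite !completion_scaleE scalerA.
Qed.

Lemma completion_scale1r : left_id 1 completion_scale.
Proof.
move=> v.
have -> : 1 = \pi_({ideal_quot (@null_ideal R I)}) 1 :> completion_ring.
  by rewrite (rmorph1 (\pi_({ideal_quot (@null_ideal R I)}))).
by rewrite completion_scaleE scale1r.
Qed.

Lemma completion_scalerDr : right_distributive completion_scale +%R.
Proof. by move=> a u v; exact: scalerDr. Qed.

Lemma completion_scalerDl v : {morph completion_scale^~ v : a b / a + b}.
Proof.
move=> a b; have [x ->] := completion_piP a; have [y ->] := completion_piP b.
rewrite -(raddfD (\pi_({ideal_quot (@null_ideal R I)}))).
by rewrite !completion_scaleE scalerDl.
Qed.

HB.instance Definition _ :=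
  GRing.Zmodule_isLmodule.Build completion_ring completion_module
  completion_scalerA completion_scale1r completion_scalerDr
  completion_scalerDl.

End Completion.

Arguments completion_ring {R} I.
Arguments completion_map {R} I a.
Arguments completion_module {R} I N.

(* Main.v *)
Require Import Defs.
From HB Require Import structures.
From mathcomp Require Import all_boot all_algebra ring_quotient
  generic_quotient.
From mathcomp Require Import boolp classical_sets functions.
Import GRing.Theory.
Local Open Scope ring_scope.
Local Open Scope quotient_scope.

Set Implicit Arguments.
Unset Strict Implicit.
Unset Printing Implicit Defensive.

(* Write [A], [M] for the completions of [R], [N]. Since [dim R/p = 1], the
   symbolic power [(pN)^(k)] is the set [S_k] of those [x] with
   [t x \in p^k N] for some [t] outside [p].

   If no prime over [z = ann y] contracts to [p], then [s^c \in z + pA] for an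
   [s \in m \ p], so [s^(ck) y \in p^k M] for all [k]. Approximating [y] by
   elements of [N] and using Artin-Rees, [y] lies in the closure of every
   [S_k]. If the topologies are equivalent this closure shrinks to [0], and
   [y = 0].

   Conversely let [Y] be the intersection of the closures of the [S_k]. For
   each [k] an element of [R \ p] maps [Y] into [p^k M], and
   [p^k M /\ Y <= pY] for large [k]; by Nakayama some [phi c + alpha] with
   [c] outside [p] and [alpha \in pA] kills [Y]. Hence no prime over the
   annihilator of a nonzero element of [Y] contracts to [p], so the hypothesis
   forces [Y = 0], and Chevalley's argument gives [S_k <= p^n N] for large
   [k]. *)

(** * Submodules and the Noetherian condition *)

(** The obstacle in the second implication is that [p^n N] need not be open for the [m]-adic
    topology, whereas Chevalley's argument controls the [S_k] only modulo powers of [m]. The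
    dimension hypothesis repairs this: [S_n / p^n N] is killed by [p^n] and by some [b] outside [p],
    and every element of [m] has a power in [p + bR]; hence [m^t N] meets [S_n] inside [p^n N] for
    large [t]. In the first implication the same hypothesis ensures that a prime of [A] over [pA]
    which misses [phi s] contracts exactly to [p].

    Neither flatness of [A] nor a tensor product description of [M] enters. The link between [N] and
    [M] is one closedness statement, [lspan_closure]: whatever is approximated to every order by a
    finitely generated submodule of [N] lies in the [A]-span of its image. It makes [M] finitely
    generated, identifies the closure of [m] in [A] with [mA], and the closure of [p^k N] in [M]
    with [p^k M]. *)

Lemma seq_bound (T : eqType) (s : seq T) (Q : nat -> T -> Prop) :
  (forall i j x, (i <= j)%N -> Q i x -> Q j x) ->
  (forall x, x \in s -> exists n, Q n x) ->
  exists n, forall x, x \in s -> Q n x.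
Proof.
move=> Qmono; elim: s => [|a s IH] Qs; first by exists 0%N.
have [|n1 H1] := IH; first by move=> x xs; apply: Qs; rewrite inE xs orbT.
have [|n2 H2] := Qs a; first by rewrite mem_head.
exists (maxn n1 n2) => x; rewrite inE => /predU1P[->|/H1].
  exact: Qmono (leq_maxr _ _) H2.
exact: Qmono (leq_maxl _ _).
Qed.

Section Submodules.
Variables (R : comNzRingType) (N : lmodType R).
Implicit Types (L K X : N -> Prop) (s : seq N).

(** Unbundled and [Prop]-valued, so that quantified conditions such as closures and saturations
    serve directly as submodules. *)
Definition submodule L := L 0 /\ forall a x y, L x -> L y -> L (a *: x + y).

Lemma subm0 L : submodule L -> L 0. Proof. by case. Qed.

Lemma submZ L a x : submodule L -> L x -> L (a *: x).
Proof. by move=> [L0 LD] Lx; rewrite -[_ *: _]addr0; apply: LD. Qed.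

Lemma submD L x y : submodule L -> L x -> L y -> L (x + y).
Proof. by move=> [_ LD] Lx Ly; rewrite -[x]scale1r; apply: LD. Qed.

Lemma submN L x : submodule L -> L x -> L (- x).
Proof. by move=> sL Lx; rewrite -scaleN1r; apply: submZ. Qed.

Lemma submB L x y : submodule L -> L x -> L y -> L (x - y).
Proof. by move=> sL Lx Ly; apply: submD => //; apply: submN. Qed.

Lemma subm_sum L (I : Type) (r : seq I) (P : pred I) (F : I -> N) :
  submodule L -> (forall i, P i -> L (F i)) -> L (\sum_(i <- r | P i) F i).
Proof.
move=> sL LF; elim/big_ind : _ => //; first exact: subm0.
by move=> x y; apply: submD.
Qed.

Lemma submodule_full : submodule (fun=> True). Proof. by []. Qed.

Lemma submoduleI L K : submodule L -> submodule K ->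
  submodule (fun x => L x /\ K x).
Proof.
move=> [L0 LD] [K0 KD]; split=> // a x y [? ?] [? ?].
by split; [apply: LD|apply: KD].
Qed.

Definition sumS L K x := exists y z, [/\ L y, K z & x = y + z].

Lemma submodule_sum L K : submodule L -> submodule K -> submodule (sumS L K).
Proof.
move=> sL sK; split; first by exists 0, 0; split; rewrite ?addr0 //;
  apply: subm0.
move=> a _ _ [y [z [Ly Kz ->]]] [y' [z' [Ly' Kz' ->]]].
exists (a *: y + y'), (a *: z + z'); split; [exact: sL.2|exact: sK.2|].
by rewrite scalerDr addrACA.
Qed.

Lemma sumSl L K x : submodule K -> L x -> sumS L K x.
Proof. by move=> sK Lx; exists x, 0; split; rewrite ?addr0//; apply: subm0. Qed.

Lemma sumSr L K x : submodule L -> K x -> sumS L K x.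
Proof. by move=> sL Kx; exists 0, x; split; rewrite ?add0r//; apply: subm0. Qed.

Lemma sumS_min L K X x : submodule X -> (forall x, L x -> X x) ->
  (forall x, K x -> X x) -> sumS L K x -> X x.
Proof. by move=> sX LX KX [y [z [/LX Xy /KX Xz ->]]]; apply: submD. Qed.

(** Coefficients are indexed by [nat], so that passing to [e :: s] is a plain shift; values from
    [size s] on are irrelevant. *)
Definition lspan s x := exists a : nat -> R, x = \sum_(i < size s) a i *: s`_i.

Lemma submodule_lspan s : submodule (lspan s).
Proof.
split; first by exists (fun=> 0); rewrite big1// => i _; rewrite scale0r.
move=> a _ _ [b ->] [c ->]; exists (fun i => a * b i + c i).
rewrite scaler_sumr -big_split; apply: eq_bigr => i _.
by rewrite scalerA scalerDl.
Qed.

Lemma mem_lspan s x : x \in s -> lspan s x.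
Proof.
move=> xs; have xi : (index x s < size s)%N by rewrite index_mem.
exists (fun i => (i == index x s)%:R).
rewrite (bigD1 (Ordinal xi)) //= eqxx scale1r nth_index // big1 ?addr0 // => i.
by rewrite -val_eqE /= => /negPf->; rewrite scale0r.
Qed.

Lemma lspan_min L s x : submodule L -> (forall y, y \in s -> L y) ->
  lspan s x -> L x.
Proof.
move=> sL Ls [a ->]; apply: subm_sum => // i _; apply: submZ => //.
by apply: Ls; rewrite mem_nth.
Qed.

Lemma lspan_consP e s x :
  lspan (e :: s) x <-> exists a y, lspan s y /\ x = a *: e + y.
Proof.
split=> [[a ->]|[a [y [sy ->]]]].
  exists (a 0%N), (\sum_(i < size s) a i.+1 *: s`_i).
  by split; [exists (fun i => a i.+1)|rewrite big_ord_recl].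
apply: (submodule_lspan _).2; first by apply: mem_lspan; rewrite mem_head.
apply: lspan_min sy; first exact: submodule_lspan.
by move=> z zs; apply: mem_lspan; rewrite inE zs orbT.
Qed.

Definition noeth := forall L, submodule L -> exists s, forall x,
  L x <-> lspan s x.

(** Without a maximal member, choice iterates strict enlargements of [L0]. The union of this chain
    is finitely generated, so one stage already contains it, a contradiction. *)
Lemma noeth_max (P : (N -> Prop) -> Prop) L0 : noeth ->
  (forall L, P L -> submodule L) -> P L0 ->
  exists2 L, P L &
    forall K, P K -> (forall x, L x -> K x) -> forall x, K x -> L x.
Proof.
move=> noN Psub PL0; apply: contrapT => nomax.
have step (D : {L | P L}) : exists E : {L | P L},
    (forall x, sval D x -> sval E x) /\ ~ (forall x, sval E x -> sval D x).
  case: D => L PL /=; apply: contrapT => noE; apply: nomax;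
    exists L => // K PK LK.
  apply: contrapT => KL; apply: noE.
  by exists (exist _ K PK).
have [f fP] := choice step.
pose D n := sval (iter n f (exist _ L0 PL0)).
have Dsub n : submodule (D n) by apply: Psub; apply: svalP.
have Dmono i j x : (i <= j)%N -> D i x -> D j x.
  move=> /subnK<-; elim: (j - i)%N => // k IH /IH; exact: (fP _).1.
have sU : submodule (fun x => exists n, D n x).
  split; first by exists 0%N; apply: subm0.
  move=> a x y [i Dx] [j Dy]; exists (maxn i j); apply: (Dsub _).2.
    exact: Dmono (leq_maxl _ _) Dx.
  exact: Dmono (leq_maxr _ _) Dy.
have [s sP] := noN _ sU.
have [||n Hn] := @seq_bound N s D; first exact: Dmono.
  by move=> x xs; apply/sP/mem_lspan.
apply: (fP (iter n f (exist _ L0 PL0))).2 => x Dx.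
apply: (lspan_min (Dsub n) Hn); apply/sP; by exists n.+1.
Qed.

Lemma noeth_stationary (D : nat -> N -> Prop) : noeth ->
  (forall n, submodule (D n)) -> (forall n x, D n x -> D n.+1 x) ->
  exists n, forall x, D n.+1 x -> D n x.
Proof.
move=> noN sD Dmono.
have [|||_ [n ->] nmax] := @noeth_max (fun L => exists n, L = D n) (D 0%N).
- exact: noN.
- by move=> L [n ->].
- by exists 0%N.
by exists n; apply: nmax; [exists n.+1|move=> x; apply: Dmono].
Qed.

End Submodules.

Arguments noeth {R} N.
Arguments submodule_lspan {R N} s.

Section FinitelyGenerated.
Variables (R : comNzRingType) (N : lmodType R).

(** Induction on [s], for submodules of [lspan s] since a tail of [s] no longer spans [N]: lifts of
    generators of the ideal of [e]-coefficients of [L], together with generators of [L] inside the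
    span of the tail, generate [L]. *)
Lemma noeth_fg (s : seq N) : noeth (R^o : lmodType R) ->
  (forall x, lspan s x) -> noeth N.
Proof.
move=> noR sN L sL; have {sN} : forall x, L x -> lspan s x by [].
elim: s L sL => [|e s IH] L sL Ls.
  by exists [::] => x; split=> [/Ls//|]; apply: lspan_min.
pose I (a : R^o) := exists2 x, L x & lspan s (x - (a : R) *: e).
have sI : submodule I.
  split; first by exists 0; rewrite ?scale0r ?subr0; [apply: subm0|
    apply: subm0; apply: submodule_lspan].
  move=> a b c [x Lx sx] [y Ly sy]; exists (a *: x + y); first exact: sL.2.
  have -> : a *: x + y - (a *: b + c : R^o) *: e
      = a *: (x - (b : R) *: e) + (y - (c : R) *: e).
    by rewrite scalerBr scalerA scalerDl opprD addrACA.
  exact: (submodule_lspan _).2.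
have [cs csP] := noR _ sI.
have fex (c : R^o) : exists x, I c -> L x /\ lspan s (x - (c : R) *: e).
  have [[x ? ?]|nI] := pselect (I c); first by exists x.
  by exists 0 => /nI.
have [f fP] := choice fex.
have [||t tP] := IH (fun x => L x /\ lspan s x).
- by apply: submoduleI => //; apply: submodule_lspan.
- by move=> x [].
have fI c : c \in cs -> I c by move=> ccs; apply/csP/mem_lspan.
exists ([seq f c | c <- cs] ++ t) => x; split; last first.
  apply: lspan_min => // y; rewrite mem_cat =>
    /orP[/mapP[c /fI/fP[Lc _] ->]//|].
  by move=> /mem_lspan/tP[].
move=> Lx; have /lspan_consP [a [y [sy xE]]] := Ls _ Lx.
have Ia : I a by exists x => //; rewrite xE addrAC subrr add0r.
suff [z [zs Lz sz]] : exists z, [/\ lspan [seq f c | c <- cs] z, L z &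
    lspan s (z - a *: e)].
  have /tP tx : L (x - z) /\ lspan s (x - z).
    split; first exact: submB.
    have -> : x - z = y - (z - a *: e) by rewrite xE opprB addrA [y + _]addrC.
    by apply: submB => //; apply: submodule_lspan.
  rewrite -[x](subrK z); apply: submD; first exact: submodule_lspan.
    apply: lspan_min tx; first exact: submodule_lspan.
    by move=> u ut; apply: mem_lspan; rewrite mem_cat ut orbT.
  apply: lspan_min zs; first exact: submodule_lspan.
  by move=> u ut; apply: mem_lspan; rewrite mem_cat ut.
have/csP := Ia.
apply: (@lspan_min _ _ (fun a : R^o => exists z,
  [/\ lspan [seq f c | c <- cs] z, L z &
    lspan s (z - (a : R) *: e)])).
  split.
    exists 0; rewrite scale0r subr0; split; [|exact: subm0|];
      exact: subm0 (submodule_lspan _).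
  move=> r b c [u [? ? ?]] [v [? ? ?]]; exists (r *: u + v).
  split; [exact: (submodule_lspan _).2|exact: sL.2|].
  have -> : r *: u + v - (r *: b + c : R^o) *: e
      = r *: (u - (b : R) *: e) + (v - (c : R) *: e).
    by rewrite scalerBr scalerA scalerDl opprD addrACA.
  exact: (submodule_lspan _).2.
move=> c ccs; exists (f c).
by have [? ?] := fP _ (fI _ ccs); split=> //; apply/mem_lspan/map_f.
Qed.

End FinitelyGenerated.

(** * Powers of ideals *)

Definition ideal (R : comNzRingType) (I : R -> Prop) :=
  @submodule R (R^o : lmodType R) I.

Definition gen (R : comNzRingType) (s : seq R) : R -> Prop :=
  @lspan R (R^o : lmodType R) s.

Section IdealPowers.
Variables (R : comNzRingType) (N : lmodType R).
Implicit Types (I : R -> Prop) (L K X : N -> Prop) (s : seq R).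

Inductive iprod I L : N -> Prop :=
| iprod_nil : iprod I L 0
| iprod_cons a x y : I a -> L x -> iprod I L y -> iprod I L (a *: x + y).

(** This is [I^t L], obtained by letting [I] act [t] times instead of forming the ideal [I^t]. *)
Definition ipow I t L := iter t (iprod I) L.

Lemma mem_iprod I L a x : I a -> L x -> iprod I L (a *: x).
Proof.
by move=> Ia Lx; rewrite -[_ *: _]addr0; apply/iprod_cons/iprod_nil.
Qed.

Lemma iprod_min I L K x : submodule K ->
  (forall a y, I a -> L y -> K (a *: y)) -> iprod I L x -> K x.
Proof.
move=> sK IL; elim=> [|a y z Ia Ly _ Kz]; first exact: subm0.
by apply: submD => //; apply: IL.
Qed.

Lemma submodule_iprod I L : submodule L -> submodule (iprod I L).
Proof.
move=> sL; split=> [|b x y Ix Iy]; first exact: iprod_nil.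
elim: Ix => [|a u v Ia Lu _ IH]; first by rewrite scaler0 add0r.
rewrite scalerDr -addrA scalerA [b * a]mulrC -scalerA.
by apply: iprod_cons => //; apply: submZ.
Qed.

Lemma submodule_ipow I t L : submodule L -> submodule (ipow I t L).
Proof. by move=> sL; elim: t => //= t; apply: submodule_iprod. Qed.

Lemma ipow_sub I t L K x : (forall y,
  L y -> K y) -> ipow I t L x -> ipow I t K x.
Proof.
move=> LK; elim: t x => [|t IH] x; first exact: LK.
by elim=> [|a u v Ia /IH Lu _]; [exact: iprod_nil|exact: iprod_cons].
Qed.

Lemma ipow_le I i j L x : submodule L -> (i <= j)%N -> ipow I j L x ->
  ipow I i L x.
Proof.
move=> sL /subnK<-; elim: (j - i)%N => // k IH; rewrite addSn.
have sP := submodule_ipow I (k + i) sL.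
by move=> /(iprod_min sP) H; apply/IH/H => a y _; apply: submZ.
Qed.

Lemma mem_ipow_exp I t L a x : I a -> L x -> ipow I t L (a ^+ t *: x).
Proof.
move=> Ia Lx; elim: t => [|t IH] /=; first by rewrite scale1r.
by rewrite exprS -scalerA; apply: mem_iprod.
Qed.

Lemma ipow_words I s t L K x : submodule K ->
  (forall a, I a -> gen s a) ->
  (forall w, size w = t -> {subset w <= s} ->
     forall y, L y -> K ((\prod_(u <- w) u) *: y)) ->
  ipow I t L x -> K x.
Proof.
move=> sK sI; elim: t K sK x => [|t IH] K sK x Kw.
  by move=> Lx; have := Kw [::] erefl _ x Lx; rewrite big_nil scale1r; apply.
apply: (iprod_min sK) => a y /sI sa Ly.
apply: (@lspan_min _ _ (fun a : R^o => K ((a : R) *: y))) sa.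
  split; first by rewrite scale0r; apply: subm0.
  by move=> b c d Kc Kd; rewrite scalerDl -scalerA; apply: sK.2.
move=> g gs; apply: (IH (fun y => K (g *: y))) (Ly).
  split; first by rewrite scaler0; apply: subm0.
  by move=> b c d Kc Kd; rewrite scalerDr scalerA mulrC -scalerA; apply: sK.2.
move=> w sw ws z Lz; rewrite scalerA.
have := Kw (g :: w); rewrite big_cons /= sw; apply=> //.
by move=> u; rewrite inE => /predU1P[->//|/ws].
Qed.

(** Pigeonhole: a word of length [t + e] contains [a] at least [e] times, or else has at least [t]
    letters among the remaining generators. *)
Lemma words_nil s X K : submodule K ->
  (forall a, a \in s -> exists e, forall x, X x -> K (a ^+ e *: x)) ->
  exists t, forall w, size w = t -> {subset w <= s} ->
    forall x, X x -> K ((\prod_(u <- w) u) *: x).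
Proof.
move=> sK; elim: s => [|a s IH] sX.
  (* Length 1 rather than 0: there is no word of length 1 over the empty alphabet, while the empty
     word would require [X] to lie in [K]. *)
  exists 1%N => -[|u w]//= _ /(_ u); rewrite mem_head in_nil => H.
  by have := H isT.
have [|t tP] := IH; first by move=> b bs; apply: sX; rewrite inE bs orbT.
have [|e eP] := sX a; first by rewrite mem_head.
exists (t + e)%N => w sw ws x Xx.
rewrite -(perm_big _ (permEl (perm_filterC (pred1 a) w))) big_cat /=.
set w1 := [seq u <- w | _ _]; set w2 := [seq u <- w | predC _ _].
have sw12 : (size w1 + size w2 = t + e)%N by rewrite !size_filter count_predC.
have -> : \prod_(u <- w1) u = a ^+ size w1.
  have /all_pred1P-> : all (pred1 a) w1 by apply: filter_all.
  by rewrite big_nseq iter_mulr_1 size_nseq.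
have [le_e|lt_e] := leqP e (size w1).
  rewrite -(subnK le_e) exprD mulrAC -scalerA.
  by apply: submZ => //; apply: eP.
have le_t : (t <= size w2)%N.
  by rewrite -(leq_add2r e) -sw12 addnC leq_add2l ltnW.
rewrite -(cat_take_drop t w2) big_cat /= mulrA mulrAC -scalerA.
apply: submZ => //; apply: tP => //; first exact: size_takel.
move=> u /mem_take; rewrite mem_filter /= => /andP[ua /ws].
by rewrite inE (negPf ua).
Qed.

(* Artin-Rees without Rees algebras: choose [K] maximal with [K /\ L = K0].
   Since [(K : g^i)] stabilises, [g^i N + K] still meets [L] in [K0], so that
   [g^i N <= K] for every generator [g] of [I]. *)
Lemma ipow_cap_sub I s L K0 : noeth N -> (forall a, I a -> gen s a) ->
  submodule L -> submodule K0 -> (forall x, K0 x -> L x) ->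
  (forall g, g \in s -> exists j, forall x, L x -> K0 (g ^+ j *: x)) ->
  exists t, forall x, ipow I t (fun=> True) x -> L x -> K0 x.
Proof.
move=> noN sI sL sK0 K0L sj.
have [||K [sK K0K KL] Kmax] := @noeth_max _ _ (fun K => [/\ submodule K,
  forall x, K0 x -> K x & forall x, K x -> L x -> K0 x]) K0 noN;
    [by move=> ? []|by []|].
suff [t tP] : exists t, forall w, size w = t -> {subset w <= s} ->
    forall x, True -> K ((\prod_(u <- w) u) *: x).
  by exists t => x xt Lx; apply: KL => //; apply: (ipow_words sK sI tP xt).
apply: words_nil => // g gs; have [j jP] := sj _ gs.
pose D i (x : N) := K (g ^+ i *: x).
have sD i : submodule (D i).
  split=> [|a x y Dx Dy]; first by rewrite /D scaler0; apply: subm0.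
  by rewrite /D scalerDr scalerA mulrC -scalerA; apply: sK.2.
have [|i iP] := noeth_stationary noN sD.
  by move=> n x; rewrite /D exprS -scalerA; apply: submZ.
have {iP}iP k x : D (k + i)%N x -> D i x.
  elim: k x => // k IH x; rewrite /D addSnnS addnC exprD -scalerA => /iP.
  by rewrite /D scalerA -exprD addnC => /IH.
exists i => x _; pose E (z : N) := exists v, z = g ^+ i *: v.
have sE : submodule E.
  split=> [|a _ _ [v ->] [w ->]]; first by exists 0; rewrite scaler0.
  by exists (a *: v + w); rewrite scalerDr !scalerA mulrC.
apply: (Kmax (sumS K E)); last first; [|by move=> y; apply: sumSl|].
  by apply: sumSr => //; exists x.
split; [exact: submodule_sum|by move=> y /K0K; apply: sumSl|].
move=> _ [y [_ [Ky [v ->] ->]]] Lyv; apply: (KL) => //; apply: submD => //.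
apply: (iP j); rewrite /D exprD -scalerA.
rewrite -[_ *: (_ *: v)](addKr (g ^+ j *: y)) -scalerDr addrC.
by apply: submB; [|apply/K0K/jP|apply: submZ].
Qed.

(** The weak form of Artin-Rees follows from [ipow_cap_sub] with [K0 = I^i L], because [g^i L] lies
    in [I^i L] for each generator [g]. *)
Lemma artin_rees I s L i : noeth N -> (forall a,
  I a <-> gen s a) -> submodule L ->
  exists t, forall x, ipow I t (fun=> True) x -> L x -> ipow I i L x.
Proof.
move=> noN sI sL; apply: (@ipow_cap_sub I s) => //; first by move=> a /sI.
- exact: submodule_ipow.
- by move=> x; apply: (@ipow_le I 0 i).
move=> g gs; exists i => x Lx; apply: mem_ipow_exp => //.
by apply/sI; apply: mem_lspan.
Qed.

Lemma iprod_consP I (s : seq N) y z : ideal I -> iprod I (lspan (y :: s)) z ->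
  exists a z', [/\ I a, iprod I (lspan s) z' & z = a *: y + z'].
Proof.
move=> sI; apply: (@iprod_min _ _ (fun z => exists a z',
  [/\ I a, iprod I (lspan s) z' & z = a *: y + z'])).
  have sP := submodule_iprod I (submodule_lspan s).
  split; first by exists 0, 0; rewrite scale0r addr0; split;
    [exact: sI.1|exact: sP.1|].
  move=> b _ _ [a [u [Ia Iu ->]]] [c [v [Ic Iv ->]]].
  exists (b * a + c), (b *: u + v); split; [exact: sI.2|exact: sP.2|].
  by rewrite scalerDr scalerA scalerDl addrACA.
move=> a _ Ia /lspan_consP[b [x [sx ->]]]; exists (a * b), (a *: x).
rewrite scalerDr scalerA; split=> //; last exact: mem_iprod.
by rewrite mulrC; apply: (submZ b sI).
Qed.

(* Nakayama / Cayley-Hamilton, with the determinant trick replaced by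
   successive elimination of the generators. *)
Lemma annihilator_gen (T I : R -> Prop) (s : seq N) : T 1 ->
  (forall a b, T a -> T b -> T (a * b)) ->
  (forall a b, T a -> I b -> T (a - b)) -> ideal I ->
  (forall y, y \in s -> exists2 a, T a & iprod I (lspan s) (a *: y)) ->
  exists2 a, T a & forall y, lspan s y -> a *: y = 0.
Proof.
move=> T1 TM TB sI; elim: s => [|y s IH] sT.
  by exists 1 => // _ [b ->]; rewrite big_ord0 scaler0.
have [|a Ta /(iprod_consP sI)[b [z [Ib Iz ayE]]]] := sT y;
  first exact: mem_head.
have {ayE} abE : (a - b) *: y = z by rewrite scalerBl ayE addrC addKr.
have [|c Tc cP] := IH.
  move=> x xs; have [|d Td /(iprod_consP sI)[e [u [Ie Iu dxE]]]] := sT x.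
    by rewrite inE xs orbT.
  (* Since [(a - b) *: y] lies in [I] times the span of [s], the factor [a - b] removes the [y]-term
     from the relation for [d *: x]. *)
  exists ((a - b) * d); first exact/TM/Td/TB.
  have sP := submodule_iprod I (submodule_lspan s).
  rewrite -scalerA dxE scalerDr scalerA mulrC -scalerA abE.
  by apply: submD => //; apply: submZ.
exists (c * (a - b)); first exact/TM/TB.
have cIs x : iprod I (lspan s) x -> c *: x = 0.
  apply: (@iprod_min _ _ (fun x => c *: x = 0)).
    split=> [|r u v cu cv]; first by rewrite scaler0.
    by rewrite scalerDr scalerA mulrC -scalerA cu cv scaler0 addr0.
  by move=> r u _ su; rewrite scalerA mulrC -scalerA cP// scaler0.
move=> _ /lspan_consP[r [x [sx ->]]].
have -> : (c * (a - b)) *: (r *: y + x) = r *: (c *: z) + (a - b) *: (c *: x).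
  rewrite scalerDr -abE !scalerA; congr (_ *: _ + _ *: _); last exact: mulrC.
  by rewrite -mulrA mulrC mulrC mulrA mulrC.
by rewrite cIs // cP // !scaler0 addr0.
Qed.

End IdealPowers.

(** * Prime ideals from maximality *)

Section NoetherianRing.
Variables (R : comNzRingType).
Hypothesis noR : noeth (R^o : lmodType R).

Definition prime_ideal (Q : R -> Prop) :=
  [/\ ideal Q, ~ Q 1 & forall a b, Q (a * b) -> Q a \/ Q b].

(** An ideal [Q] maximal among those containing [J] and disjoint from [T] is prime: for [a], [b]
    outside [Q] both [Q + (a)] and [Q + (b)] meet [T], hence so does [Q + (ab)]. *)
Lemma prime_avoiding (J T : R -> Prop) : ideal J -> T 1 ->
  (forall a b, T a -> T b -> T (a * b)) -> (forall a, T a -> ~ J a) ->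
  exists Q, [/\ prime_ideal Q, forall a, J a -> Q a & forall a, T a -> ~ Q a].
Proof.
move=> sJ T1 TM TJ.
have [||Q [sQ JQ TQ] Qmax] := @noeth_max _ _ (fun Q : R^o -> Prop =>
  [/\ submodule Q, forall x, J x -> Q x & forall a, T a -> ~ Q a]) J noR;
  [by move=> ? []|by []|].
exists Q; split=> //; split=> // [|a b Qab]; first exact: TQ.
have meets c : ~ Q c -> exists r q, Q q /\ T (r * c + q).
  move=> nQc; apply: contrapT => nT; apply: nQc.
  apply: (Qmax (sumS (gen [:: c]) Q)); last first.
  - by apply: sumSl => //; apply: mem_lspan; rewrite mem_head.
  - by move=> x; apply: sumSr; apply: submodule_lspan.
  split; [exact: submodule_sum (submodule_lspan _) sQ| |].
    by move=> x /JQ; apply: sumSr; apply: submodule_lspan.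
  move=> t Tt [_ [q [/lspan_consP[r [_ [[? ->] ->]]] Qq tE]]]; apply: nT.
  exists r, q; split=> //; move: Tt; rewrite tE big_ord0 addr0; exact.
apply: contrapT => /not_orP[/meets[r [q [Qq Ta]]] /meets[r' [q' [Qq' Tb]]]].
apply: (TQ _ (TM _ _ Ta Tb)).
rewrite mulrDl !mulrDr -addrA.
have QM x y : Q y -> Q (x * y) by move=> Qy; apply: (submZ x sQ).
apply: (submD sQ); first by rewrite mulrACA; apply: QM.
by apply: (submD sQ); [apply: QM|apply: (submD sQ); [rewrite mulrC|];
  apply: QM].
Qed.

(** A maximal annihilator of nonzero elements of [Y] is prime; thus a nonzero [Y] yields an
    associated prime with a witness in [Y]. *)
Lemma exists_prime_annihilator (M : lmodType R) (Y : M -> Prop) y0 :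
  submodule Y -> Y y0 -> y0 <> 0 ->
  exists2 y, Y y & prime_ideal (fun a => a *: y = 0).
Proof.
move=> sY Yy0 y0_neq0.
have sann (y : M) : ideal (fun a => a *: y = 0).
  split=> [|a b c]; first by rewrite scale0r.
  by move=> by0 cy0; rewrite scalerDl -scalerA by0 cy0 scaler0 addr0.
have [||J [y [Yy y_neq0 ->]] Jmax] := @noeth_max _ _ (fun J : R^o -> Prop =>
  exists y, [/\ Y y, y <> 0 & J = (fun a : R => a *: y = 0)])
  (fun a : R => a *: y0 = 0) noR.
- by move=> _ [y [_ _ ->]]; apply: sann.
- by exists y0.
exists y => //; split=> // [|a b aby]; first by rewrite scale1r.
have [|by_neq0] := pselect (b *: y = 0); [by right|left].
apply: (Jmax (fun a : R => a *: (b *: y) = 0)).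
- by exists (b *: y); split=> //; apply: submZ.
- by move=> c cy; rewrite scalerA mulrC -scalerA cy scaler0.
by rewrite scalerA.
Qed.

End NoetherianRing.

(** * Descending chains and abstract completions *)

Section DescendingChains.
Variables (R : comNzRingType) (N : lmodType R) (m : R -> Prop).
Hypothesis m_max : forall r, ~ m r -> exists r', m (1 - r * r').
Hypothesis noN : noeth N.
Variable D : nat -> N -> Prop.
Hypothesis sD : forall n, submodule (D n).
Hypothesis D_le : forall i j x, (i <= j)%N -> D j x -> D i x.

Let stationary_mod X :=
  exists k, forall j x, (k <= j)%N -> D k x -> sumS (D j) X x.

(** [X / X'] is generated by the class of [e] and killed by [m], so it is zero or simple. Either
    every [D j + X'] contains [e], and [X] may be replaced by [X']; or some [D i + X'] does not, and
    beyond [i] the [X]-components already lie in [X'], as a coefficient outside [m] could be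
    inverted to reach [e]. *)
Let stationary_step X X' e : submodule X -> submodule X' ->
  (forall x, X' x -> X x) ->
  (forall x, X x -> exists a, X' (x - a *: e)) -> (forall a,
    m a -> X' (a *: e)) ->
  X e -> stationary_mod X -> stationary_mod X'.
Proof.
move=> sX sX' X'X Xe me Xee [k kP].
have [De|] := pselect (forall j, sumS (D j) X' e).
  exists k => j x kj Dx; have sS := submodule_sum (sD j) sX'.
  apply: (sumS_min sS _ _ (kP _ _ kj Dx)) => [y|y /Xe[a X'ya]].
    exact: sumSl.
  by rewrite -[y](subrK (a *: e)); apply: submD => //;
    [exact: sumSr|exact: submZ].
move=> /existsNP[i nDi]; exists (maxn k i) => j x;
  rewrite geq_max => /andP[kj ij] Dx.
have [y [z [Dy Xz xE]]] := kP _ _ kj (D_le (leq_maxl k i) Dx).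
exists y, z; split=> //; have [a X'za] := Xe _ Xz.
have [/me ma|/m_max[b mb]] := pselect (m a).
  by rewrite -[z](subrK (a *: e)); apply: submD.
case: nDi; have Diz : D i z.
  rewrite -[z](addKr y) -xE addrC; apply: submB => //; last exact: D_le Dy.
  exact: D_le (leq_maxr k i) Dx.
exists (b *: z), (e - b *: z); split; [exact: submZ| |by rewrite addrC subrK].
have -> : e - b *: z = (1 - a * b) *: e - b *: (z - a *: e).
  by rewrite scalerBr scalerA scalerBl scale1r opprB addrA [b * a]mulrC subrK.
by apply: submB => //; [exact: me|exact: submZ].
Qed.

Let stationary_iprod X : submodule X -> stationary_mod X ->
  stationary_mod (iprod m X).
Proof.
move=> sX; have [es esP] := noN sX; have sZ := submodule_iprod m sX.
have ZX x : iprod m X x -> X x by apply: iprod_min => // a y _; apply: submZ.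
pose Z := iprod m X.
(* Descend from [X] to [mX] by dropping one generator at a time; each quotient met on the way falls
   under [stationary_step]. *)
suff {es esP} H es X1 : submodule X1 -> (forall x, X1 x -> X x) ->
    (forall x, Z x -> X1 x) -> (forall e, e \in es -> X1 e) ->
    (forall x, X1 x -> sumS (lspan es) Z x) ->
    stationary_mod X1 -> stationary_mod Z.
  apply: (H es) => // [e ees|x /esP]; [exact/esP/mem_lspan|exact: sumSl].
elim: es X1 => [|e es IH] X1 sX1 X1X ZX1 X1es X1s PX.
  case: PX => k kP; exists k => j x kj /(kP _ _ kj).
  apply: sumS_min => [|y|y /X1s]; [exact: submodule_sum| |].
    exact: sumSl.
  by move=> [_ [z [[? ->] Zz ->]]]; rewrite big_ord0 add0r; apply: sumSr.
have sS := submodule_sum (submodule_lspan es) sZ.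
have S1 x : sumS (lspan es) Z x -> X1 x.
  apply: sumS_min => // y; apply: lspan_min => // f fes.
  by apply: X1es; rewrite inE fes orbT.
apply: (IH (sumS (lspan es) Z)) => //.
- by move=> x /S1/X1X.
- by move=> x; apply/sumSr/submodule_lspan.
- by move=> f fes; apply/sumSl/mem_lspan.
apply: (@stationary_step X1 _ e) => //.
- move=> x /X1s[_ [z [/lspan_consP[a [y [sy ->]]] Zz ->]]]; exists a.
  by exists y, z; split=> //; rewrite addrAC [a *: e + y]addrC addrK.
- move=> a ma; apply: sumSr; first exact: submodule_lspan.
  by apply: mem_iprod => //; apply/X1X/X1es/mem_head.
by apply/X1es/mem_head.
Qed.

(** Stands in for the finite length of [N / m^t N]. *)
Lemma dcc_mod_ipow t : exists k, forall j x, (k <= j)%N -> D k x ->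
  sumS (D j) (ipow m t (fun=> True)) x.
Proof.
elim: t => [|t IH]; first by exists 0%N => j x _ _; apply: sumSr.
by apply: stationary_iprod => //; apply: submodule_ipow.
Qed.

End DescendingChains.

Section AbstractCompletion.
Variables (R A : comNzRingType) (phi : {rmorphism R -> A}) (m : R -> Prop).

(* [psi : N -> M] exhibits [M] as the completion of [N] for the filtration
   [m^k N], where [G k] is the closure of the image of [m^k N] and [F] is the
   corresponding filtration of [A]. *)
Record completes (F : nat -> A -> Prop) (N : lmodType R) (M : lmodType A)
    (psi : N -> M) (G : nat -> M -> Prop) : Prop := {
  psi_lin : forall a x y, psi (a *: x + y) = phi a *: psi x + psi y;
  G_submod : forall k, submodule (G k);
  G_le : forall i j x, (i <= j)%N -> G j x -> G i x;
  G_scale : forall k a x, F k a -> G k (a *: x);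
  G_psi : forall k x, G k (psi x) <-> ipow m k (fun=> True) x;
  G_sep : forall x, (forall k, G k x) -> x = 0;
  G_dense : forall k x, exists u, G k (x - psi u);
  G_complete : forall w : nat -> M, (forall i, G i (w i)) ->
    exists d, forall k, G k (d - \sum_(i < k) w i) }.

Section Closure.
Variables (F : nat -> A -> Prop) (N : lmodType R) (M : lmodType A).
Variables (psi : N -> M) (G : nat -> M -> Prop).
Hypothesis cN : completes F psi G.

Lemma psi0 : psi 0 = 0.
Proof.
have := psi_lin cN 1 0 0; rewrite rmorph1 !scale1r addr0.
by move=> /(congr1 (fun x => x - psi 0)); rewrite addrK subrr.
Qed.

Lemma psiD x y : psi (x + y) = psi x + psi y.
Proof. by have := psi_lin cN 1 x y; rewrite rmorph1 !scale1r. Qed.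

Lemma psiZ a x : psi (a *: x) = phi a *: psi x.
Proof. by have := psi_lin cN a x 0; rewrite psi0 !addr0. Qed.

Lemma psiB x y : psi (x - y) = psi x - psi y.
Proof. by rewrite psiD -scaleN1r psiZ rmorphN1 scaleN1r. Qed.

Lemma psi_sum (I : Type) (r : seq I) (f : I -> N) :
  psi (\sum_(i <- r) f i) = \sum_(i <- r) psi (f i).
Proof. exact: (big_morph psi psiD psi0). Qed.

Lemma ipow_coef (I : R -> Prop) t (s : seq N) x :
  ipow I t (lspan s) x -> exists2 b : nat -> R,
    forall j, @ipow R (R^o : lmodType R) I t (fun=> True) (b j) &
    x = \sum_(j < size s) b j *: s`_j.
Proof.
elim: t x => [|t IH] x; first by move=> [b ->]; exists b.
have sP := submodule_ipow I t.+1 (@submodule_full R (R^o : lmodType R)).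
apply: (@iprod_min _ _ _ _ (fun x => exists2 b : nat -> R, forall j,
  @ipow R (R^o : lmodType R) I t.+1 (fun=> True) (b j) &
    x = \sum_(j < size s) b j *: s`_j)).
  split.
    exists (fun=> 0) => [j|]; first exact: sP.1.
    by rewrite big1// => i _; rewrite scale0r.
  move=> a _ _ [b bP ->] [c cP ->]; exists (fun j => a * b j + c j).
    by move=> j; apply: sP.2.
  rewrite scaler_sumr -big_split; apply: eq_bigr => j _.
  by rewrite scalerDl scalerA.
move=> a y Ia /IH[b bP ->]; exists (fun j => a * b j).
  by move=> j; exact: (mem_iprod Ia (bP j)).
by rewrite scaler_sumr; apply: eq_bigr => j _; rewrite scalerA.
Qed.

Hypothesis cR : @completes F (R^o : lmodType R) (A^o : lmodType A) phi F.

Lemma F_phi k a : F k (phi a) <-> @ipow R (R^o : lmodType R) m k (fun=> True) a.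
Proof. exact: (G_psi cR). Qed.

(** By Artin-Rees the successive differences of good approximants to [y] lie in [m^i] times the span
    of [hs]. Their coefficients can then be taken in [m^i], so the coefficient series converge in
    [A]. *)
Lemma lspan_closure (gm : seq R) (hs : seq N) y : noeth N ->
  (forall a, m a <-> gen gm a) ->
  (forall t, exists2 v, lspan hs v & G t (y - psi v)) ->
  lspan (map psi hs) y.
Proof.
move=> noN gmP yP.
have [t tP] := choice (fun i => artin_rees i noN gmP (submodule_lspan hs)).
(* Nondecreasing and above both [i] and [t i]; the Artin-Rees exponents [t i] need not be
   monotone. *)
pose T i := (i + \sum_(j < i.+1) t j)%N.
have T_mono i : (T i <= T i.+1)%N by rewrite leq_add // [leqRHS]big_ord_recr
  leq_addr.
have t_T i : (t i <= T i)%N by rewrite /T big_ord_recr /= addnA leq_addl.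
have [v vP] : exists v : nat -> N, forall i,
  lspan hs (v i) /\ G (T i) (y - psi (v i)).
  have [v vP] := choice (fun i => (let: ex_intro2 v sv Gv := yP (T i) in
    ex_intro (fun v => lspan hs v /\ G (T i) (y - psi v)) v (conj sv Gv))).
  by exists v.
have [b bP] : exists b : nat -> nat -> R, forall i,
    (forall j, @ipow R (R^o : lmodType R) m i (fun=> True) (b i j)) /\
    v i.+1 - v i = \sum_(j < size hs) b i j *: hs`_j.
  suff /choice[b bP] : forall i, exists bi : nat -> R,
    (forall j, @ipow R (R^o : lmodType R) m i (fun=> True) (bi j)) /\
    v i.+1 - v i = \sum_(j < size hs) bi j *: hs`_j by exists b.
  move=> i; have [|bi ? ?] := @ipow_coef m i hs (v i.+1 - v i);
    last by exists bi.
  have [[svi Gvi] [svi1 Gvi1]] := (vP i, vP i.+1).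
  apply: tP; last by apply: submB => //; apply: submodule_lspan.
  apply: (ipow_le _ (t_T i)) => //; apply/(G_psi cN); rewrite psiB.
  have -> : psi (v i.+1) - psi (v i) = (y - psi (v i)) - (y - psi (v i.+1)).
    by rewrite opprB [RHS]addrC addrA subrK.
  by apply: submB; [exact: G_submod cN _|by []|exact: (G_le cN (T_mono i))].
have [d dP] : exists d : nat -> A, forall j k,
  F k (d j - \sum_(i < k) phi (b i j)).
  have [d dP] := choice (fun j => G_complete cR
    (fun i => (G_psi cR i (b i j)).2 ((bP i).1 j))).
  by exists d.
have [c cE] := (vP 0%N).1.
exists (fun j => phi (c j) + d j); apply/eqP; rewrite -subr_eq0; apply/eqP.
apply: (G_sep cN) => k; rewrite size_map.
have vkE : v k = v 0%N + \sum_(i < k) (v i.+1 - v i).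
  by rewrite -(big_mkord xpredT (fun i =>
    v i.+1 - v i)) telescope_sumr // addrC subrK.
have yvk : G k (y - psi (v k)).
  by apply: (G_le cN _ (vP k).2); apply: leq_addr.
rewrite -[y](subrK (psi (v k))) -addrA; apply: submD => //;
  first exact: G_submod cN _.
rewrite vkE psiD cE !psi_sum.
under [X in _ + X - _]eq_bigr => i _ do rewrite (bP i).2 psi_sum.
rewrite exchange_big -big_split -sumrB.
apply: subm_sum => [|j _]; first exact: G_submod cN _.
rewrite (nth_map 0) //.
under eq_bigr => i _ do rewrite psiZ.
rewrite psiZ -scaler_suml [in X in _ - X]scalerDl opprD addrACA subrr add0r.
rewrite -scalerBl -opprB scaleNr.
by apply: submN; [exact: G_submod cN _|exact: (G_scale cN _ (dP j k))].
Qed.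

End Closure.

Section NoetherianCompletion.
Variables (F : nat -> A -> Prop) (gm : seq R).
Hypothesis cR : @completes F (R^o : lmodType R) (A^o : lmodType A) phi F.
Hypothesis noR : noeth (R^o : lmodType R).
Hypothesis gmP : forall a, m a <-> gen gm a.
Hypothesis m_max : forall r, ~ m r -> exists r', m (1 - r * r').

Lemma F1P a : F 1%N a <-> gen (map phi gm) a.
Proof.
have sF := G_submod cR 1; have idm : ideal m.
  by split=> [|b x y /gmP mx /gmP my]; apply/gmP;
    [exact: (submodule_lspan _).1|exact: (submodule_lspan _).2].
have F1_phi b : F 1%N (phi b) <-> m b.
  split=> [/(F_phi cR)|mb].
    by apply: (iprod_min idm) => x y mx _; rewrite /GRing.scale /= mulrC;
      exact: (submZ y idm mx).
  apply/(F_phi cR); rewrite -[b]mulr1; exact: (mem_iprod mb).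
split=> [Fa|]; last first.
  apply: (lspan_min sF) => _ /mapP[g ggm ->].
  by apply/F1_phi/gmP/mem_lspan.
apply: (lspan_closure cR cR noR gmP) => t.
(* Precision at least 1 forces the approximant [v] into [m], hence into the span of [gm]. *)
have [v vP] := G_dense cR (maxn t 1) a.
exists v; last exact: (G_le cR (leq_maxl t 1)).
apply/gmP/F1_phi; rewrite -[phi v](subKr a).
by apply: (submB sF) => //; apply: (G_le cR (leq_maxr t 1)).
Qed.

End NoetherianCompletion.
End AbstractCompletion.

(** * The completion is Noetherian *)

Definition fg (R : comNzRingType) (N : lmodType R) (L : N -> Prop) :=
  exists s, forall x, L x <-> lspan s x.

(** Zorn's lemma applies because a finitely generated union of a nonempty chain of submodules equals
    one of its members. *)
Lemma max_nonfg (R : comNzRingType) (N : lmodType R) : ~ noeth N ->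
  exists J : N -> Prop, [/\ submodule J, ~ fg J & forall K, submodule K ->
    (forall x, J x -> K x) -> ~ (forall x, K x -> J x) -> fg K].
Proof.
move=> /existsNP[J0 /not_implyP[sJ0 nfJ0]].
(* The alternative [set0] is there for the union of the empty chain; [J0] later rules it out as a
   maximal element. *)
have [|J [PJ Jmax]] := @Zorn_bigcup N
    (fun X => X = set0 \/ (submodule X /\ ~ fg X)).
  move=> C PC totC; have [|] := pselect (exists2 X, C X & (X !=set0)%classic);
    last first.
    move=> C0; left; apply/seteqP; split=> // x [X CX Xx].
    by apply: C0; exists X => //; exists x.
  move=> [X0 CX0 X0_neq0]; right.
  have CP X x : C X -> X x -> submodule X /\ ~ fg X.
    by move=> CX Xx; have [X_eq0|//] := PC _ CX; rewrite X_eq0 in Xx.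
  have ub X Y : C X -> C Y -> exists2 Z, C Z & (X `<=` Z /\ Y `<=` Z)%classic.
    by move=> CX CY; have [XY|YX] := totC _ _ CX CY; [exists Y => //;
      split|exists X => //; split].
  have sU : submodule (\bigcup_(X in C) X)%classic.
    split; first by exists X0 => //; have [x Xx] := X0_neq0;
      exact: (CP _ _ CX0 Xx).1.1.
    move=> a x y [X CX Xx] [Y CY Yy]; have [Z CZ [XZ YZ]] := ub _ _ CX CY.
    exists Z => //; have [[_ ZD] _] := CP _ _ CZ (XZ _ Xx).
    by apply: ZD; [exact: XZ|exact: YZ].
  split=> // -[s sP].
  have [Z [CZ X0Z sZ]] : exists Z, [/\ C Z, X0 `<=` Z &
      forall x, x \in s -> Z x]%classic.
    have : forall x, x \in s -> (\bigcup_(X in C) X)%classic x.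
      by move=> x xs; apply/sP/mem_lspan.
    elim: {sP} s => [|e s IH] sU'; first by exists X0; split.
    have [|Z [CZ X0Z sZ]] := IH.
      by move=> x xs; apply: sU'; rewrite inE xs orbT.
    have [|X CX Xe] := sU' e; first exact: mem_head.
    have [Y CY [XY ZY]] := ub _ _ CX CZ; exists Y; split=> //.
      exact: subset_trans ZY.
    by move=> x; rewrite inE => /predU1P[->|/sZ/ZY//]; apply: XY.
  have [x0 /X0Z Zx0] := X0_neq0; have [sZZ] := CP _ _ CZ Zx0; apply.
  exists s => x; split=> [Zx|]; first by apply/sP; exists Z.
  exact: lspan_min.
case: PJ => [J_eq0|[sJ nfJ]].
  exfalso; apply: (Jmax J0); last by right; split.
  by rewrite J_eq0 properEneq; split; [apply/eqP => J00; have := sJ0.1;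
    rewrite -J00|].
exists J; split=> // K sK JK nKJ; apply: contrapT => nfK.
by apply: (Jmax K); [split|right].
Qed.

Section NoetherianCompletion.
Variables (R A : comNzRingType) (phi : {rmorphism R -> A}) (m : R -> Prop).
Variables (F : nat -> A -> Prop) (gm : seq R).
Hypothesis cR : @completes R A phi m F (R^o : lmodType R) (A^o : lmodType A)
  phi F.
Hypothesis noR : noeth (R^o : lmodType R).
Hypothesis gmP : forall a, m a <-> gen gm a.
Hypothesis m_max : forall r, ~ m r -> exists r', m (1 - r * r').

(* As in Cohen's theorem, an ideal [J] maximal among those not finitely
   generated satisfies [(J : a) = J] for [a] outside [J]. Choosing [a] in the
   image of [m], one gets [J = J0 + a J] with [J0 <= J] finitely generated, and
   expanding in powers of [a] yields [J = J0] by completeness. *)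
Lemma noeth_completion : noeth (A^o : lmodType A).
Proof.
apply: contrapT => /max_nonfg[J [sJ nfJ Jmax]].
have JM x y : J y -> J (x * y) by move=> Jy; apply: (submZ (x : A) sJ Jy).
(* If [J] contains [mA], then [J] is [mA] or contains a unit modulo [mA] and is all of [A]; both are
   finitely generated. *)
have [gJ|] := pselect (forall g, g \in gm -> J (phi g)).
  have FJ a : F 1%N a -> J a.
    by move=> /(F1P cR noR gmP); apply: lspan_min => // _ /mapP[g /gJ Jg ->].
  have [JF|/existsNP[b /not_implyP[Jb nFb]]] :=
    pselect (forall x, J x -> F 1%N x).
    by apply: nfJ; exists (map phi gm) => x;
      split=> [/JF/(F1P cR noR gmP)|/(F1P cR noR gmP)/FJ].
  have [r Fbr] := G_dense cR 1 b; apply: nfJ.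
  have nmr : ~ m r.
    move=> mr; apply: nFb; rewrite -[b](subrK (phi r)).
    apply: (submD (G_submod cR 1)) => //.
    by apply/(F_phi cR); rewrite -[r]mulr1; apply: (mem_iprod mr).
  have [r' mr'] := m_max nmr.
  have J1 : J 1.
    rewrite -(rmorph1 phi) -(subrK (r * r') 1) rmorphD rmorphM /=.
    rewrite -[phi r](subKr b) mulrBl; apply: (submD sJ).
      apply: FJ; apply/(F_phi cR); rewrite -[X in ipow _ _ _ X]mulr1.
      exact: (mem_iprod mr').
    by apply: (submB sJ); rewrite mulrC; apply: JM => //; apply: FJ.
  exists [:: 1] => x; split=> _; last by rewrite -[x]mulr1; apply: JM.
  have : lspan [:: 1 : A^o] (x *: 1) by apply: (submZ (x : A) (submodule_lspan
    _)); apply/mem_lspan/mem_head.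
  by rewrite /GRing.scale /= mulr1.
move=> /existsNP[g /not_implyP[ggm nJa]]; set a := phi g in nJa.
have Fa k x : F k (a ^+ k * x).
  have Fak : F k (a ^+ k).
    rewrite -rmorphXn; apply/(F_phi cR); rewrite -[_ ^+ _]mulr1.
    by apply: (@mem_ipow_exp R (R^o : lmodType R)) => //; apply/gmP/mem_lspan.
  by rewrite mulrC; exact: (submZ x (G_submod cR k) Fak).
(* [J + aA] is strictly larger than [J], hence finitely generated; [js] collects the [J]-components
   of its generators. *)
have [js jsJ jsP] : exists2 js : seq A, forall y, y \in js -> J y &
    forall x, J x -> exists c, gen js (x - c * a).
  have [|||l lP] := Jmax (@sumS A (A^o : lmodType A) (gen [:: a]) J).
  - by apply: submodule_sum => //; apply: submodule_lspan.
  - by move=> x; apply: sumSr; apply: submodule_lspan.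
  - by move=> SJ; apply: nJa; apply: SJ; apply: sumSl => //;
    apply/mem_lspan/mem_head.
  have /choice[f fP] : forall x, exists y, x \in l -> J y /\ exists c,
    x = c * a + y.
    move=> x; have [xl|] := boolP (x \in l); last by exists 0.
    have /lP[_ [y [/lspan_consP[c [_ [[? ->] ->]]] Jy xE]]] := mem_lspan xl.
    by exists y => _; split=> //; exists c; rewrite xE big_ord0 addr0.
  exists (map f l) => [_ /mapP[x /fP[Jf _] ->]//|x Jx].
  have sp := @submodule_lspan A (A^o : lmodType A) (map f l).
  have /lP : @sumS A (A^o : lmodType A) (gen [:: a]) J x by apply: sumSr => //;
    apply: submodule_lspan.
  apply: (@lspan_min A (A^o : lmodType A) (fun x => exists c,
    gen (map f l) (x - c * a))).
    split; first by exists 0; rewrite mul0r subr0; apply: sp.1.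
    move=> b y z [c cP] [d dP]; exists (b * c + d).
    have -> : b *: y + z - (b * c + d) * a = b * (y - c * a) + (z - d * a).
      by rewrite /GRing.scale /= mulrBr mulrDl opprD mulrA addrACA.
    exact: (sp.2 b).
  move=> y yl; have [_ [c yE]] := fP _ yl; exists c.
  by rewrite {1}yE addrC addKr; apply/mem_lspan/map_f.
have jsJ' x : gen js x -> J x by apply: lspan_min.
(* If [(J : a)] were strictly larger than [J], it would be generated by some [d], and [js] with the
   multiples [c * a], [c] in [d], would generate [J]. *)
have [JaJ|nJaJ] := pselect (forall c, J (c * a) -> J c); last first.
  have [|||d dP] := Jmax (fun c => J (c * a)).
  - split=> [|b x y Jx Jy]; first by rewrite mul0r; apply: subm0.
    by rewrite mulrDl -mulrA; apply: (sJ.2 b).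
  - by move=> x Jx; rewrite mulrC; apply: JM.
  - by move=> H; apply: nJaJ => c /H.
  apply: nfJ; exists (js ++ [seq c * a | c <- d]) => x; split; last first.
    apply: lspan_min => // y; rewrite mem_cat => /orP[/jsJ//|/mapP[c cd ->]].
    exact/(dP c)/mem_lspan.
  move=> Jx; have [c cx] := jsP x Jx.
  have sp := @submodule_lspan A (A^o : lmodType A) (js ++ [seq c * a | c <- d]).
  rewrite -[x](subrK (c * a)); apply: (submD sp).
    by apply: lspan_min cx => // y yjs; apply: mem_lspan; rewrite mem_cat yjs.
  have /dP : J (c * a).
    by rewrite -[c * a](subKr x); apply: (submB sJ) => //; apply: jsJ'.
  apply: (@lspan_min A (A^o : lmodType A) (fun c => lspan _ (c * a))).
    split=> [|b y z Jy Jz]; first by rewrite mul0r; apply: sp.1.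
    by rewrite mulrDl -mulrA; apply: (sp.2 b).
  by move=> y yd; apply: mem_lspan; rewrite mem_cat; apply/orP; right;
    apply/mapP; exists y.
have /choice[f fP] : forall x, exists y, J x -> J y /\ gen js (x - y * a).
  move=> x; have [Jx|] := pselect (J x); last by exists 0.
  have [y xy] := jsP x Jx; exists y => _; split=> //; apply: JaJ.
  by rewrite -[y * a](subKr x); apply: (submB sJ) => //; apply: jsJ'.
apply: nfJ; exists js => x; split=> [Jx|]; last exact: jsJ'.
(* Successive quotients in the expansion of [x] along [a]: the remainder [a ^+ k * X k] tends to 0,
   and the coefficient of each element of [js] is a convergent series in powers of [a]. *)
pose X i := iter i f x.
have JX i : J (X i) by elim: i => //= i /fP[].
have /choice[b bE] i : exists b : nat -> A, X i - X i.+1 * a =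
    \sum_(j < size js) b j * js`_j.
  by have [_ [b bE]] := fP _ (JX i); exists b.
have /choice[d dP] j : exists d, forall k,
  F k (d - \sum_(i < k) a ^+ i * b i j).
  exact: (G_complete cR (fun i => Fa i (b i j))).
exists d; apply/eqP; rewrite -subr_eq0; apply/eqP; apply: (G_sep cR) => k.
have sF := G_submod cR k.
have xE : x = a ^+ k * X k + \sum_(i < k) \sum_(j < size js) a ^+ i * b i j *
  js`_j.
  elim: k {sF} => [|k IH]; first by rewrite big_ord0 mul1r addr0.
  rewrite {1}IH big_ord_recr [RHS]addrCA addrC; congr (_ + _).
  under eq_bigr => j _ do rewrite -mulrA.
  by rewrite -mulr_sumr -bE mulrBr exprSr [X k.+1 * a]mulrC mulrA addrC subrK.
rewrite xE exchange_big -addrA -sumrB; apply: (submD sF); first exact: Fa.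
apply: (@subm_sum A (A^o : lmodType A) (F k) _ (index_enum 'I_(size js)) xpredT
  _ sF) => j _; rewrite -mulr_suml -mulrBl -opprB mulNr.
apply: (submN sF); rewrite mulrC; exact: (submZ js`_j sF (dP j k)).
Qed.

End NoetherianCompletion.

(** * Completion by Cauchy sequences *)

Section IdealXPow.
Variables (R : comNzRingType) (I : {pred R}).

Lemma smulP (N : lmodType R) (J : {pred R}) (L : {pred N}) x :
  x \in smul J L <-> iprod (fun a => a \in J) (fun y => y \in L) x.
Proof.
split=> [/asboolP[s [sP ->]]|].
  elim: s sP => [|u s IH] sP; first by rewrite big_nil; apply: iprod_nil.
  rewrite big_cons; have [uJ uL] := sP u (mem_head _ _).
  by apply: iprod_cons => //; apply: IH => v vs; apply: sP; rewrite inE vs orbT.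
elim=> [|a y z aJ yL _ /asboolP[s [sP ->]]]; apply/asboolP.
  by exists [::]; rewrite big_nil.
exists ((a, y) :: s); rewrite big_cons; split=> // u.
by rewrite inE => /predU1P[->//|/sP].
Qed.

(** [idealX] multiplies inside the ring before acting on [N], while [ipow] acts one factor at a
    time; associativity of the action reconciles them. *)
Lemma imod_idealXP (N : lmodType R) k (x : N) :
  x \in imod N (idealX I k) <-> ipow (fun a => a \in I) k (fun=> True) x.
Proof.
elim: k x => [|k IH] x.
  split=> // _; apply/smulP; rewrite -[x]scale1r; exact: mem_iprod.
have sN := @submodule_iprod R N (fun a => a \in idealX I k.+1) (fun y =>
  y \in predT)
  (conj isT (fun _ _ _ _ _ => isT)).
have sP := submodule_ipow (fun a => a \in I) k.+1 (submodule_full N).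
split=> [/smulP|].
  apply: (iprod_min sP) => a y /smulP aI _.
  apply: (@iprod_min R (R^o : lmodType R) (fun a => a \in I)
    (fun a => a \in idealX I k) (fun a =>
      ipow _ k.+1 _ ((a : R) *: y)) a _ _ aI).
    split=> [|b c d cI dI]; first by rewrite scale0r; apply: sP.1.
    by rewrite scalerDl -scalerA; apply: sP.2.
  move=> b c bI cI; rewrite -scalerA; apply: mem_iprod => //; apply/IH/smulP.
  exact: mem_iprod.
move=> xI; apply/smulP; apply: (iprod_min sN) xI => a y aI /IH/smulP.
apply: (@iprod_min _ _ _ _ (fun y => iprod _ _ (a *: y))).
  split=> [|b c d cI dI]; first by rewrite scaler0; apply: sN.1.
  by rewrite scalerDr scalerA mulrC -scalerA; apply: sN.2.
move=> b z bI _; rewrite scalerA; apply: mem_iprod => //; apply/smulP.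
exact: (@mem_iprod R (R^o : lmodType R)).
Qed.

End IdealXPow.

Section CauchyLimits.
Variables (R : comNzRingType) (m : {pred R}) (N : lmodType R).

Definition eventually_in k (c : nat -> N) :=
  exists n0, forall n, (n0 <= n)%N -> c n \in imod N (idealX m k).

Lemma imod_idealX_le i j (x : N) : (i <= j)%N ->
  x \in imod N (idealX m j) -> x \in imod N (idealX m i).
Proof. by move=> ij /imod_idealXP/(ipow_le (submodule_full N) ij)/imod_idealXP.
  Qed.

Lemma cauchy_series (w : nat -> nat -> N) : (forall i, w i \in cauchy m N) ->
  (forall i, eventually_in i (w i)) -> exists2 d : nat -> N, d \in cauchy m N &
    forall k, eventually_in k (fun n => d n - \sum_(i < k) w i n).
Proof.
move=> wC /choice[n0 wn0].
pose d n : N := \sum_(i < n) if (n0 i <= n)%N then w i n else 0.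
have dP k : eventually_in k (fun n => d n - \sum_(i < k) w i n).
  exists (k + \sum_(i < k) n0 i)%N => n kn.
  have /subnKC nE : (k <= n)%N := leq_trans (leq_addr _ _) kn.
  rewrite /d -nE big_split_ord /= nE addrAC -sumrB big1 ?add0r => [|i _].
    rewrite rpred_sum // => i _; case: ifP => [in0|_]; last exact: rpred0.
    exact: imod_idealX_le (leq_addr i k) (wn0 _ _ in0).
  have -> : (n0 i <= n)%N; last by rewrite subrr.
  by apply: leq_trans kn; rewrite (bigD1 i) //= addnCA leq_addr.
exists d => //; apply/asboolP => k; have [n1 dn1] := dP k.
have : \sum_(i < k) w i \in cauchy m N by rewrite rpred_sum.
move=> /asboolP/(_ k)[n2 wn2]; exists (maxn n1 n2) => i j.
rewrite !geq_max => /andP[i1 i2] /andP[j1 j2].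
rewrite -[d i](subrK (\sum_(l < k) w l i)) -[d j](subrK (\sum_(l < k) w l j)).
rewrite opprD addrACA; apply: rpredD; first by apply: rpredB; apply: dn1.
by have := wn2 i j i2 j2; rewrite !fct_sumE.
Qed.

End CauchyLimits.

Section CompletionByCauchySequences.
Variables (R A : comNzRingType) (m : idealr R) (N : lmodType R) (M : lmodType
  A).
Variables (rho : cauchy_ring m -> A) (pi : cauchy_module m N -> M).
Hypothesis piB : forall c d, pi (c - d) = pi c - pi d.
Hypothesis pi_scale : forall a c, rho a *: pi c = pi (cauchy_module_scale a c).
Hypothesis pi_surj : forall x, exists c, x = pi c.
Hypothesis pi_eq0 : forall c, pi c = 0 <-> null_seq m (val c).

Definition seq_filtration k x :=
  exists2 c, x = pi c & eventually_in m k (val c).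

Lemma seq_filtrationP k c : seq_filtration k (pi c) <->
  eventually_in m k (val c).
Proof.
split=> [[d /eqP]|]; last by exists c.
rewrite -subr_eq0 -piB => /eqP/pi_eq0/(_ k)[i cdi] [j dj].
exists (maxn i j) => n; rewrite geq_max => /andP[ni nj].
by rewrite -[val c n](subrK (val d n)); apply: rpredD; [apply: cdi|apply: dj].
Qed.

Lemma cst_cauchy_module (u : N) : (fun=> u) \in cauchy m N.
Proof. by apply/asboolP => k; exists 0%N => i j _ _; rewrite subrr rpred0. Qed.

Definition cst_module (u : N) : cauchy_module m N :=
  exist _ (fun=> u) (cst_cauchy_module u).

Lemma pi0 : pi 0 = 0.
Proof. by rewrite -(subrr 0) piB subrr. Qed.

Lemma piD c d : pi (c + d) = pi c + pi d.
Proof. by rewrite -{1}[d]opprK piB -[- d]sub0r piB pi0 sub0r opprK. Qed.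

(** Abstract quotient maps [rho] and [pi] let one argument serve both the completed ring, a quotient
    by an ideal, and the completed module, a quotient by a submodule. *)
Lemma completes_seq (phi : {rmorphism R -> A}) (psi : N -> M) :
  (forall u, psi u = pi (cst_module u)) ->
  (forall a, phi a = rho (exist _ (fun=> a) (cst_cauchy m a))) ->
  (forall a, exists c, a = rho c) ->
  @completes R A phi (fun a => a \in m)
    (fun k a => exists2 c : cauchy_ring m, a = rho c &
       @eventually_in R m (R^o : lmodType R) k (val c))
    N M psi seq_filtration.
Proof.
move=> /funext-> phiE rho_surj; split.
- move=> a x y; rewrite phiE pi_scale -piD; congr pi; exact: val_inj.
- move=> k; split.
    by exists 0; rewrite ?pi0 //; exists 0%N => n _; apply: rpred0.
  move=> a x y; have [b ->] := rho_surj a; move=> [c -> [i ci]] [d -> [j dj]].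
  exists (cauchy_module_scale b c + d); first by rewrite pi_scale piD.
  exists (maxn i j) => n; rewrite geq_max => /andP[ni nj].
  by apply: rpredD; [apply: rpredZ; apply: ci|apply: dj].
- move=> i j x ij [c -> [n0 cn]]; exists c => //; exists n0 => n /cn.
  exact: imod_idealX_le.
- move=> k a x [c -> [n0 cn]]; have [d ->] := pi_surj x.
  exists (cauchy_module_scale c d); first by rewrite pi_scale.
  by exists n0 => n /cn; apply: imodR_scale.
- move=> k x; rewrite -imod_idealXP seq_filtrationP; split=> [[n0]|xk].
    by move=> /(_ n0); apply.
  by exists 0%N.
- move=> x; have [c ->] := pi_surj x => xG; apply/pi_eq0 => k.
  exact/seq_filtrationP/xG.
- move=> k x; have [c ->] := pi_surj x.
  have /asboolP/(_ k)[n0 cn0] := valP c; exists (val c n0).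
  by rewrite -piB; apply/seq_filtrationP; exists n0 => n ?; apply: cn0.
move=> w wG; have [c wE] := choice (fun i => pi_surj (w i)).
have [i|i|d dC dP] := @cauchy_series R m N (fun i => val (c i)).
- exact: valP.
- by apply/seq_filtrationP; rewrite -wE.
exists (pi (exist _ d dC)) => k.
have -> : \sum_(i < k) w i = pi (\sum_(i < k) c i).
  by rewrite (big_morph pi piD pi0); apply: eq_bigr => i _; rewrite wE.
rewrite -piB; apply/seq_filtrationP; have [n0 dn0] := dP k.
have valE n : val (\sum_(i < k) c i) n = \sum_(i < k) val (c i) n.
  by elim/big_ind2: _ => // x u y v <- <-.
exists n0 => n /dn0; rewrite -valE; exact.
Qed.

End CompletionByCauchySequences.

Section AdicCompletion.
Variables (R : comNzRingType) (m : idealr R).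

Definition completion_filtration k (a : completion_ring m) :=
  exists2 c : cauchy_ring m, a = \pi_({ideal_quot (@null_ideal R m)}) c &
    @eventually_in R m (R^o : lmodType R) k (val c).

Lemma completion_ring_surj a : exists c,
  a = \pi_({ideal_quot (@null_ideal R m)}) c.
Proof. exact: completion_piP. Qed.

Lemma completes_module (N : lmodType R) :
  exists (psi : N -> completion_module m N) G,
    @completes _ _ (@completion_map R m) (fun a =>
      a \in m) completion_filtration
      N (completion_module m N) psi G.
Proof.
pose pi (c : cauchy_module m N) : completion_module m N :=
  \pi_(quotmod (@null_submod R m N)) c.
have piD c d : pi (c + d) = pi c + pi d by exact: quotmod_piD.
have pi0 : pi 0 = 0 by apply: (addrI (pi 0)); rewrite -piD !addr0.
exists (fun u => pi (cst_module m u)), (seq_filtration pi).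
apply: (@completes_seq R (completion_ring m) m N (completion_module m N)
  (fun c => \pi_({ideal_quot (@null_ideal R m)}) c) pi) => //.
- by move=> c d; apply: (addIr (pi d)); rewrite -piD !subrK.
- move=> a c; rewrite [LHS](completion_scaleE a (pi c)); exact: quotmod_piZ.
- by move=> x; exists (repr (x : quotmod _)); rewrite /pi reprK.
- move=> c; rewrite -pi0 quotmod_piE subr0; split=> [/asboolP//|cn].
  exact/asboolP.
exact: completion_ring_surj.
Qed.

Lemma completes_ring :
  @completes _ _ (@completion_map R m) (fun a => a \in m) completion_filtration
    (R^o : lmodType R) (completion_ring m)^o (@completion_map R m)
    completion_filtration.
Proof.
apply: (@completes_seq R (completion_ring m) m (R^o : lmodType R)
  (completion_ring m)^o
  (fun c => \pi_({ideal_quot (@null_ideal R m)}) c)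
  (fun c => \pi_({ideal_quot (@null_ideal R m)}) c)) => //.
- move=> c d; have -> : c - d = ((c : cauchy_ring m) - (d : cauchy_ring m)) by
  exact: val_inj.
  exact: (raddfB (\pi_({ideal_quot (@null_ideal R m)}))).
- move=> a c; have -> : cauchy_module_scale a c = a * (c : cauchy_ring m) by
  exact: val_inj.
  exact: (esym (rmorphM (\pi_({ideal_quot (@null_ideal R m)})) a c)).
- exact: completion_ring_surj.
- move=> c; rewrite -[0](raddf0 (\pi_({ideal_quot (@null_ideal R m)}))).
  split=> [/eqP|cn]; last (apply/eqP); rewrite -Quotient.idealrBE subr0;
    first by move=> /asboolP.
  exact/asboolP.
- by move=> u; congr (\pi _); apply: val_inj.
exact: completion_ring_surj.
Qed.

End AdicCompletion.

(** * Comparison of the topologies *)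

Section PrimeContraction.
Variables (R A : comNzRingType) (phi : {rmorphism R -> A}).

Lemma prime_contraction (Q : A -> Prop) : prime_ideal Q ->
  prime_ideal (fun a => Q (phi a)).
Proof.
move=> [sQ nQ1 QM]; split; last 2 first.
- by rewrite rmorph1.
- by move=> a b; rewrite rmorphM; apply: QM.
split=> [|a b c Qb Qc]; first by rewrite rmorph0; apply: sQ.1.
by rewrite rmorphD rmorphM; apply: (sQ.2 (phi a)).
Qed.

End PrimeContraction.

Lemma primeX (R : comNzRingType) (Q : R -> Prop) a n : prime_ideal Q ->
  Q (a ^+ n) -> Q a.
Proof. by case=> _ nQ1 QM; elim: n => // n IH; rewrite exprS => /QM[]. Qed.

Lemma ipow_subl (R : comNzRingType) (N : lmodType R) (I J : R -> Prop) t
    (L : N -> Prop) x : (forall a, I a -> J a) -> ipow I t L x -> ipow J t L x.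
Proof.
move=> IJ; elim: t x => // t IH x.
by elim=> [|a u v /IJ Ja /IH Lu _]; [exact: iprod_nil|exact: iprod_cons].
Qed.

Section Saturation.
Variables (R : comNzRingType) (N : lmodType R) (p : R -> Prop).
Hypothesis p_prime : prime_ideal p.

(** The contraction to [N] of [p^k N_p]. *)
Definition saturated k (x : N) :=
  exists2 t, ~ p t & ipow p k (fun=> True) (t *: x).

Lemma nprimeM a b : ~ p a -> ~ p b -> ~ p (a * b).
Proof. by move=> na nb; case: p_prime => _ _ pM /pM[]. Qed.

Lemma submodule_saturated k : submodule (saturated k).
Proof.
have sP := submodule_ipow p k (submodule_full N).
split; first by exists 1; [case: p_prime|rewrite scaler0; apply: sP.1].
move=> a x y [t nt xt] [u nu yu]; exists (t * u); first exact: nprimeM.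
have -> : (t * u) *: (a *: x + y) = (u * a) *: (t *: x) + t *: (u *: y).
  by rewrite scalerDr !scalerA -mulrA [t * _]mulrC.
by apply: submD => //; apply: submZ.
Qed.

Lemma ipow_saturated k x : ipow p k (fun=> True) x -> saturated k x.
Proof. by exists 1; [case: p_prime|rewrite scale1r]. Qed.

Lemma saturated_le i j x : (i <= j)%N -> saturated j x -> saturated i x.
Proof.
by move=> ij [t nt xt]; exists t => //; apply: ipow_le ij xt;
  apply: submodule_full.
Qed.

Lemma saturated_uniform k : noeth N -> exists2 t, ~ p t &
  forall x, saturated k x -> ipow p k (fun=> True) (t *: x).
Proof.
move=> noN; have sP := submodule_ipow p k (submodule_full N).
have [s sE] := noN _ (submodule_saturated k).
have [t nt tP] : exists2 t, ~ p t &
    forall x, x \in s -> ipow p k (fun=> True) (t *: x).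
  have : forall x, x \in s -> saturated k x by move=> x xs; apply/sE/mem_lspan.
  elim: {sE} s => [|x s IH] sat; first by exists 1; case: p_prime.
  have [|t nt tP] := IH; first by move=> y ys; apply: sat; rewrite inE ys orbT.
  have [|u nu ux] := sat x; first exact: mem_head.
  exists (t * u) => [|y]; first exact: nprimeM.
  rewrite inE => /predU1P[->|/tP ty]; first by rewrite -scalerA; apply: submZ.
  by rewrite mulrC -scalerA; apply: submZ.
exists t => // x /sE; apply: (@lspan_min _ _ (fun x => ipow _ _ _ (t *: x))) =>
  //.
split=> [|a y z py pz]; first by rewrite scaler0; apply: sP.1.
by rewrite scalerDr scalerA mulrC -scalerA; apply: sP.2.
Qed.

(** [m^n (wN + P)] lies in [w m^n N + P]. This allows an approximant to be corrected by an element
    of [m^n N] so that [w] sends it into [P]. *)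
Lemma ipow_shift (m : R -> Prop) (w : R) (P : N -> Prop) n x : submodule P ->
  ipow m n (sumS (fun z => exists u, z = w *: u) P) x ->
  exists2 u, ipow m n (fun=> True) u & P (x - w *: u).
Proof.
move=> sP; elim: n x => [|n IH] x.
  by move=> [_ [y [[u ->] Py ->]]]; exists u => //; rewrite addrC addKr.
have sI := submodule_ipow m n.+1 (submodule_full N).
apply: (@iprod_min _ _ _ _ (fun x => exists2 u,
  ipow m n.+1 (fun=> True) u & P (x - w *: u))).
  split; first by exists 0; [exact: sI.1|rewrite scaler0 subr0; exact: sP.1].
  move=> a y z [u Iu Pu] [v Iv Pv]; exists (a *: u + v); first exact: sI.2.
  have -> : a *: y + z - w *: (a *: u + v) = a *: (y - w *: u) + (z - w *: v).
    by rewrite scalerDr opprD addrACA scalerBr !scalerA mulrC.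
  exact: sP.2.
move=> a y ma /IH[u Iu Pu]; exists (a *: u); first exact: mem_iprod.
have -> : a *: y - w *: (a *: u) = a *: (y - w *: u).
  by rewrite scalerBr !scalerA mulrC.
exact: submZ.
Qed.

End Saturation.

(** * Closures in the completion and the two implications *)

Section SymbolicTopology.
Variables (R A : comNzRingType) (phi : {rmorphism R -> A}) (N : lmodType R).
Variables (M : lmodType A) (psi : N -> M) (m p : R -> Prop) (gm gp : seq R).
Variables (F : nat -> A -> Prop) (G : nat -> M -> Prop) (s : R).
Hypothesis cR : @completes R A phi m F (R^o : lmodType R) (A^o : lmodType A)
  phi F.
Hypothesis cN : @completes R A phi m F N M psi G.
Hypothesis noR : noeth (R^o : lmodType R).
Hypothesis noN : noeth N.
Hypothesis gmP : forall a, m a <-> gen gm a.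
Hypothesis gpP : forall a, p a <-> gen gp a.
Hypothesis m_max : forall r, ~ m r -> exists r', m (1 - r * r').
Hypothesis p_prime : prime_ideal p.
Hypothesis pm : forall a, p a -> m a.
Hypothesis ms : m s.
Hypothesis nps : ~ p s.
Hypothesis dim1 : forall Q, prime_ideal Q -> (forall a, p a -> Q a) ->
  (exists2 a, Q a & ~ p a) -> forall a, m a -> Q a.

Let noA : noeth (A^o : lmodType A) := noeth_completion cR noR gmP m_max.

Let noM : noeth M.
Proof.
have [es esP] := noN (submodule_full N).
apply: (@noeth_fg A M (map psi es)) => // x.
apply: (lspan_closure cN cR noN gmP) => t.
by have [u ?] := G_dense cN t x; exists u => //; apply/esP.
Qed.

Let pA : A -> Prop := gen (map phi gp).

Let pA_ideal : ideal pA. Proof. exact: submodule_lspan. Qed.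

Let pA_phi a : p a -> pA (phi a).
Proof.
move=> /gpP; apply: (@lspan_min R (R^o : lmodType R) (fun a => pA (phi a))).
  split=> [|b c d pc pd]; first by rewrite rmorph0; apply: pA_ideal.1.
  by rewrite rmorphD rmorphM; apply: (pA_ideal.2 (phi b)).
by move=> g ggp; apply/mem_lspan/map_f.
Qed.

Let pA_sub (Q : A -> Prop) : ideal Q -> (forall a, p a -> Q (phi a)) ->
  forall a, pA a -> Q a.
Proof.
move=> sQ pQ a; apply: (lspan_min sQ) => _ /mapP[g ggp ->].
by apply/pQ/gpP/mem_lspan.
Qed.

Let ipow_psi k v : ipow p k (fun=> True) v -> ipow pA k (fun=> True) (psi v).
Proof.
elim: k v => // k IH v.
have sP := submodule_ipow pA k.+1 (submodule_full M).
apply: (@iprod_min _ _ _ _ (fun v => ipow pA k.+1 (fun=> True) (psi v))).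
  split=> [|a x y px py]; first by rewrite (psi0 cN); apply: sP.1.
  by rewrite (psi_lin cN); apply: sP.2.
by move=> a y /pA_phi pa /IH py; rewrite (psiZ cN); apply: mem_iprod.
Qed.

Let approx k (x : M) := forall t, exists2 v,
  ipow p k (fun=> True) v & G t (x - psi v).

(** The closure of [L] is stable under [A] because a scalar [a] may be replaced by some [phi r], at
    the cost of the small error [(a - phi r) *: x]. *)
Let submodule_approx (L : N -> Prop) : submodule L ->
  submodule (fun x => forall t, exists2 v, L v & G t (x - psi v)).
Proof.
move=> sL; split=> [t|a x y xL yL t].
  exists 0; [exact: sL.1|rewrite (psi0 cN) subr0].
  exact: (G_submod cN t).1.
have sG := G_submod cN t.
have [r Fr] := G_dense cR t a.
have [u Lu Gu] := xL t; have [v Lv Gv] := yL t.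
exists (r *: u + v); first exact: sL.2.
have -> : a *: x + y - psi (r *: u + v) =
    phi r *: (x - psi u) + (y - psi v) + (a - phi r) *: x.
  rewrite (psi_lin cN) scalerBr scalerBl opprD.
  rewrite addrACA [RHS]addrAC; congr (_ + _).
  by rewrite [RHS]addrC addrA subrK.
by apply: submD => //; [exact: sG.2|exact: (G_scale cN)].
Qed.

Let approxP k x : approx k x <-> ipow pA k (fun=> True) x.
Proof.
split=> [xk|].
  have sP := submodule_ipow p k (submodule_full N).
  have [hs hsP] := noN sP.
  have : lspan (map psi hs) x.
    apply: (lspan_closure cN cR noN gmP) => t.
    by have [v vk Gv] := xk t; exists v => //; apply/hsP.
  apply: lspan_min; first exact/submodule_ipow/submodule_full.
  by move=> _ /mapP[h hhs ->]; apply/ipow_psi/hsP/mem_lspan.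
elim: k x => [|k IH] x.
  by move=> _ t; have [u Gu] := G_dense cN t x; exists u.
have sP := submodule_ipow p k.+1 (submodule_full N).
have sA := submodule_approx sP.
apply: (iprod_min sA) => a y pa yk.
apply: (@lspan_min A (A^o : lmodType A) (fun a =>
  approx k.+1 ((a : A) *: y))) pa.
  split=> [|b c d cy dy]; first by rewrite scale0r; apply: sA.1.
  by rewrite scalerDl -scalerA; apply: sA.2.
move=> _ /mapP[g ggp ->] t; have [v vk Gv] := IH y yk t.
exists (g *: v); first by apply: mem_iprod => //; apply/gpP/mem_lspan.
by rewrite (psiZ cN) -scalerBr; apply: (submZ _ (G_submod cN t)).
Qed.

Let equiv_sat := forall n, exists k, forall x : N,
  saturated p k x -> ipow p n (fun=> True) x.

Lemma contraction_of_equiv (y : M) : equiv_sat ->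
  prime_ideal (fun a => a *: y = 0) ->
  exists Q, [/\ prime_ideal Q, forall a, a *: y = 0 -> Q a &
    forall a, Q (phi a) <-> p a].
Proof.
move=> eqv [z_ideal z1 _]; pose J :=
  @sumS A (A^o : lmodType A) (fun a : A => a *: y = 0) pA.
have sJ : submodule J by apply: submodule_sum.
apply: contrapT => nQ.
(* Otherwise a prime over [J] avoids the powers of [phi s]. Its contraction contains [p] but not
   [s], so [dim1] makes it equal to [p]. *)
have [c [zeta [alpha [zeta0 palpha scE]]]] : exists c, J (phi (s ^+ c)).
  apply: contrapT => /forallNP nJ.
  have [|||Q [Qprime JQ QT]] := prime_avoiding noA (T :=
    fun a => exists c, a = phi (s ^+ c)) sJ.
  - by exists 0%N; rewrite rmorph1.
  - by move=> _ _ [i ->] [j ->]; exists (i + j)%N; rewrite exprD rmorphM.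
  - by move=> _ [i ->].
  have pQ a : p a -> Q (phi a) by move=> pa; apply: JQ; apply: sumSr => //;
    apply: pA_phi.
  apply: nQ; exists Q; split=> // [a ay|a]; first by apply/JQ/sumSl.
  split=> [Qa|/pQ//]; apply: contrapT => npa; apply: (QT (phi s)).
    by exists 1%N.
  apply: (@dim1 (fun a => Q (phi a))) => //; first exact: prime_contraction.
  by exists a.
apply: z1; rewrite scale1r; apply: (G_sep cN) => n.
have [k kP] := eqv n; pose w := s ^+ (c * k).
have npw : ~ p w by move/(primeX p_prime).
have sy : phi (s ^+ c) *: y = alpha *: y by rewrite scE scalerDl zeta0 add0r.
have wyE : phi w *: y = alpha ^+ k *: y.
  rewrite /w exprM rmorphXn; elim: k {kP w npw} => // k IH.
  rewrite exprSr -scalerA sy scalerA mulrC -scalerA IH.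
  by rewrite scalerA -exprS.
have /approxP wy : ipow pA k (fun=> True) (phi w *: y).
  by rewrite wyE; apply: mem_ipow_exp.
have sP := submodule_ipow p k (submodule_full N).
(* For approximants [u] of [y] and [v] of [phi w *: y], the element [w *: u - v] of [wN + p^k N] is
   [m]-adically small; Artin-Rees turns this into membership in [m^n (wN + p^k N)]. *)
have [|t tP] := @artin_rees _ _ m gm
    (sumS (fun z => exists u, z = w *: u) (ipow p k (fun=> True))) n noN gmP.
  apply: submodule_sum => //; split; first by exists 0; rewrite scaler0.
  by move=> a _ _ [u ->] [v ->]; exists (a *: u + v);
    rewrite scalerDr !scalerA mulrC.
pose T := maxn t n.
have [u Gu] := G_dense cN T y; have [v pv Gv] := wy T.
have : ipow m n (sumS (fun z => exists u, z = w *: u) (ipow p k (fun=> True)))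
    (w *: u - v).
  apply: tP; last first.
    by exists (w *: u), (- v); split=> //; [exists u|apply: submN].
  apply: (ipow_le (submodule_full N) (leq_maxl t n)).
  apply/(G_psi cN); rewrite (psiB cN) (psiZ cN).
  have -> : phi w *: psi u - psi v =
      (phi w *: y - psi v) - phi w *: (y - psi u).
    by rewrite scalerBr opprB [RHS]addrC addrA subrK.
  by apply: (submB (G_submod cN T)) => //; apply: (submZ _ (G_submod cN T)).
move=> /(ipow_shift sP)[u' mu' pu'].
(* Now [u - u'] lies in [p^n N], hence in [m^n N], and so does [u']: thus [u], and with it [y], is
   small to order [n]. *)
have /kP pu : saturated p k (u - u').
  exists w => //; have -> : w *: (u - u') = (w *: u - v - w *: u') + v.
    by rewrite scalerBr addrAC subrK.
  exact: submD.
rewrite -[y](subrK (psi u)); apply: (submD (G_submod cN n)).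
  exact: (G_le cN (leq_maxr t n)).
apply/(G_psi cN); rewrite -[u](subrK u').
apply: (submD (submodule_ipow m n (submodule_full N))) => //.
exact: ipow_subl pu.
Qed.

(** Supplies the openness that [p^n N] may lack, by [ipow_cap_sub]: each generator [g] of [m] has a
    power mapping [S_n] into [p^n N]. *)
Let sat_cap_ipow n : exists t, forall x : N, ipow m t (fun=> True) x ->
  saturated p n x -> ipow p n (fun=> True) x.
Proof.
have sP := submodule_ipow p n (submodule_full N).
have sS := submodule_saturated N p_prime n.
have [b npb bP] := saturated_uniform p_prime n noN.
apply: (@ipow_cap_sub _ _ m gm) => //; first by move=> a /gmP.
  exact: ipow_saturated.
move=> g ggm.
(* If no power of [g] were in [(b) + p], some prime strictly above [p] would miss [g], against
   [dim1]. *)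
have [e [c [q [pq geE]]]] : exists e c q, p q /\ g ^+ e = c * b + q.
  apply: contrapT => /forallNP ne.
  pose J := @sumS R (R^o : lmodType R) (gen [:: b]) p.
  have [|||a [e ->]|Q [Qprime JQ QT]] := prime_avoiding noR (J := J) (T :=
    fun a => exists e, a = g ^+ e).
  - by apply: submodule_sum; [apply: submodule_lspan|case: p_prime].
  - by exists 0%N.
  - by move=> _ _ [i ->] [j ->]; exists (i + j)%N; rewrite exprD.
  - move=> [_ [q [/lspan_consP[c [_ [[? ->] ->]]] pq geE]]]; apply: (ne e).
    by exists c, q; split=> //; rewrite geE big_ord0 addr0.
  apply: (QT g); first by exists 1%N.
  apply: (@dim1 Q) => //; last exact/gmP/mem_lspan.
    by move=> a pa; apply: JQ; apply: sumSr => //; apply: submodule_lspan.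
  exists b => //; apply: JQ; apply: sumSl; first by case: p_prime.
  exact/mem_lspan/mem_head.
exists (e * n)%N => x Sx.
(* By induction [g ^+ (e * i) *: x] lies in [p^i S_n + p^n N]: in [g ^+ e = c * b + q], [q] raises
   the power of [p] and [b] sends [S_n] into [p^n N]. *)
have : sumS (ipow p n (saturated p n)) (ipow p n (fun=>
  True)) (g ^+ (e * n) *: x).
  elim: {1 4}n => [|i [y [z [Iy Pz xE]]]].
    by apply: sumSl => //; rewrite muln0 expr0 scale1r.
  have sI := submodule_ipow p i.+1 sS.
  have Sy : saturated p n y by apply: (ipow_le (i := 0) sS _ Iy).
  rewrite mulnS exprD -scalerA xE scalerDr {1}geE scalerDl -scalerA.
  exists (q *: y), (c *: (b *: y) + g ^+ e *: z); split.
  - exact: mem_iprod.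
  - by apply: submD => //; apply: submZ => //; apply: bP.
  - by rewrite addrA [q *: y + _]addrC.
by apply: sumS_min => // y; apply: ipow_sub.
Qed.

(* Chevalley's argument: by the descending chain condition modulo the powers
   of [m], a compatible sequence of elements of the saturations can be chosen,
   and its limit is not zero. *)
Let chevalley n : (forall k, exists2 x : N,
  saturated p k x & ~ ipow p n (fun=> True) x) ->
  exists2 y : M, y <> 0 &
    forall k t, exists2 v, saturated p k v & G t (y - psi v).
Proof.
move=> nsat; have [t0 t0P] := sat_cap_ipow n.
have [k0 k0P] := choice (fun t => dcc_mod_ipow m_max noN
  (submodule_saturated N p_prime) (@saturated_le R N p) t).
(* Nondecreasing and above [n], [t] and [k0 t]: [n] places the starting point in [S_n], [t] makes
   the indices unbounded, and [k0 t] is where stationarity modulo [m^t] begins. *)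
pose k t := (n + t + \sum_(i < t.+1) k0 i)%N.
have k0k t : (k0 t <= k t)%N by rewrite /k big_ord_recr /= addnA leq_addl.
have kS t : (k t <= k t.+1)%N.
  by rewrite /k [in leqRHS]big_ord_recr /= leq_add ?leq_addr // leq_add.
have /choice[f fP] : forall tx : nat * N, exists x' : N,
  saturated p (k tx.1) tx.2 ->
    saturated p (k tx.1.+1) x' /\ ipow m tx.1 (fun=> True) (x' - tx.2).
  case=> t x /=; have [kx|] := pselect (saturated p (k t) x); last by exists 0.
  have [x' [z [Sx' mz xE]]] := k0P t _ _ (leq_trans (k0k t) (kS t))
    (saturated_le (k0k t) kx).
  exists x' => _; split=> //; rewrite xE opprD addNKr.
  exact: (submN (submodule_ipow m t (submodule_full N))).
(* Starting at stage [t0] keeps every correction in [m^t0 N]; a zero limit would put [x0] in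
   [m^t0 N], hence in [p^n N] by the choice of [t0]. *)
have [x0 Sx0 nPx0] := nsat (k t0).
pose u := fix u i := if i is i'.+1 then f ((t0 + i')%N, u i') else x0.
have Su i : saturated p (k (t0 + i)%N) (u i).
  elim: i => [|i IH] /=; first by rewrite addn0.
  by rewrite addnS; have [] := fP (_, _) IH.
have uS i : ipow m (t0 + i) (fun=> True) (u i.+1 - u i).
  by have [] := fP (_, _) (Su i).
have [d dP] : exists d, forall i, G i (d - \sum_(j < i) psi (u j.+1 - u j)).
  apply: (G_complete cN (w := fun j => psi (u j.+1 - u j))) => i.
  apply/(G_psi cN); exact: (ipow_le (submodule_full N) (leq_addl t0 i)).
pose y := psi x0 + d.
have Gyu i : G i (y - psi (u i)).
  have -> : y - psi (u i) = d - \sum_(j < i) psi (u j.+1 - u j); last exact: dP.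
  rewrite -(psi_sum cN) -(big_mkord xpredT (fun j => u j.+1 - u j)).
  by rewrite telescope_sumr // (psiB cN) opprB addrA [d + _]addrC.
exists y => [y0|i t].
  apply: nPx0; apply: t0P; last first.
    by apply: saturated_le Sx0; rewrite /k -addnA leq_addr.
  apply/(G_psi cN).
  have := Gyu t0; rewrite y0 sub0r => /(submN (G_submod cN t0)); rewrite opprK.
  have : G t0 (psi (u t0 - x0)).
    apply/(G_psi cN); rewrite -[x0]/(u 0%N) -telescope_sumr // big_mkord.
    apply: subm_sum => [|j _]; first exact: submodule_ipow (submodule_full N).
    exact: (ipow_le (submodule_full N) (leq_addr j t0)).
  rewrite (psiB cN) => Gd Gu; rewrite -[psi x0](subKr (psi (u t0))).
  exact: (submB (G_submod cN t0)).
exists (u (maxn i t)); last exact: (G_le cN (leq_maxr i t)).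
apply: saturated_le (Su _); rewrite /k -!addnA;
  apply: leq_trans (leq_maxl i t) _.
by rewrite addnC -!addnA addnCA leq_addr.
Qed.

Lemma equiv_of_contraction :
  (forall y : M, prime_ideal (fun a => a *: y = 0) ->
    exists Q, [/\ prime_ideal Q, forall a, a *: y = 0 -> Q a &
      forall a, Q (phi a) <-> p a]) -> equiv_sat.
Proof.
move=> contr n; apply: contrapT => /forallNP nequiv.
have [k|y y_neq0 Yy] := @chevalley n.
  by have /existsNP[x /not_implyP[? ?]] := nequiv k; exists x.
pose Y (z : M) := forall k t, exists2 v, saturated p k v & G t (z - psi v).
have sY : submodule Y.
  have sA k := submodule_approx (submodule_saturated N p_prime k).
  split=> [k|a z w Yz Yw k]; first exact: (sA k).1.
  by apply: (sA k).2; [exact: Yz|exact: Yw].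
have pA_gen a : pA a -> gen (map phi gp) a by [].
(* Artin-Rees over [A] with exponent 1: [p^k M] meets [Y] inside [pY]. *)
have [||k kP] := @ipow_cap_sub A M pA (map phi gp) Y (iprod pA Y) noM pA_gen sY
  (submodule_iprod pA sY).
- by move=> z; apply: (iprod_min sY) => a w _; apply: submZ.
- move=> g ggp; exists 1%N => z Yz; rewrite expr1.
  by apply: mem_iprod => //; exact: (@mem_lspan A (A^o : lmodType A) _ _ ggp).
have [b npb bP] := saturated_uniform p_prime k noN.
have bY z : Y z -> iprod pA Y (phi b *: z).
  move=> Yz; apply: kP; last exact: (submZ _ sY Yz).
  apply/approxP => t; have [v /bP bv Gv] := Yz k t.
  by exists (b *: v) => //; rewrite (psiZ cN) -scalerBr;
    apply: (submZ _ (G_submod cN t)).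
pose T tau := exists c alpha, [/\ ~ p c, pA alpha & tau = phi c + alpha].
have [ys ysP] := noM sY.
have pM x z : pA z -> pA (x * z) by move=> pz;
  exact: (submZ (x : A) pA_ideal pz).
have T1 : T 1.
  by exists 1, 0; rewrite rmorph1 addr0; split=> //;
    [case: p_prime|exact: pA_ideal.1].
have TM a d : T a -> T d -> T (a * d).
  move=> [c [q [npc pq ->]]] [{}d [r [npd pr ->]]].
  exists (c * d), (phi c * r + q * (phi d + r)); split; first exact: nprimeM.
    by apply: (submD pA_ideal); [|rewrite mulrC]; apply: pM.
  by rewrite mulrDl mulrDr rmorphM addrA.
have TB a r : T a -> pA r -> T (a - r).
  move=> [c [q [npc pq ->]]] pr; exists c, (q - r); rewrite addrA.
  by split=> //; apply: (submB pA_ideal).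
have [|tau [c [alpha [npc palpha tauE]]] tau0] :=
  annihilator_gen T1 TM TB pA_ideal (s := ys).
  move=> z zys; have /bY bz : Y z by apply/ysP/mem_lspan.
  exists (phi b); first by exists b, 0; rewrite addr0; split=> //;
    exact: pA_ideal.1.
  apply: (iprod_min _ _ bz); first exact/submodule_iprod/submodule_lspan.
  by move=> a w pa /ysP Yw; apply: mem_iprod.
have [z Yz zprime] := exists_prime_annihilator noA sY Yy y_neq0.
have [Q [Qprime zQ Qp]] := contr _ zprime; have [sQ _ _] := Qprime.
apply: npc; apply/Qp; have -> : phi c = tau - alpha by rewrite tauE addrK.
apply: (submB sQ); first by apply: zQ; apply: tau0; apply/ysP.
by apply: (pA_sub sQ) palpha => a /Qp.
Qed.

End SymbolicTopology.

(** * Bundled ideals and local rings *)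

Lemma generated_byP (R : comNzRingType) (N : lmodType R) (s : seq N) (L : {pred
  N}) :
  generated_by s L <-> forall x, x \in L <-> lspan s x.
Proof.
suff E x : (exists a : 'I_(size s) -> R,
  x = \sum_(i < size s) a i *: s`_i) <-> lspan s x.
  by split=> sL x; split=> [/sL/E|/E/sL].
split=> [[a ->]|[a ->]]; last by exists a.
exists (fun i => oapp a 0 (insub i)); apply: eq_bigr => i _.
by rewrite valK.
Qed.

Lemma noetherian_noeth (R : comNzRingType) (N : lmodType R) :
  noetherian_module N -> noeth N.
Proof.
move=> noN L sL; pose P : {pred N} := fun x => `[< L x >].
have PC : submod_closed P.
  split=> [|a x y /asboolP Lx /asboolP Ly]; apply/asboolP; first exact: sL.1.
  exact: sL.2.
pose S : submodClosed N := HB.pack P (GRing.isSubmodClosed.Build R N P PC).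
have [s /generated_byP sS] := noN S.
by exists s => x; rewrite -sS; split=> /asboolP.
Qed.

Lemma ideal_idealr (R : comNzRingType) (I : idealr R) : ideal (fun a =>
  a \in I).
Proof. by split=> [|a b c bI cI]; [exact: rpred0|rewrite rpredD ?idealMr]. Qed.

Lemma exists_idealr (R : comNzRingType) (J : R -> Prop) : ideal J -> ~ J 1 ->
  exists I : idealr R, forall a, a \in I <-> J a.
Proof.
move=> sJ nJ1; pose P : {pred R} := fun a => `[< J a >].
have PC : idealr_closed P.
  split; first exact/asboolP/sJ.1.
    by apply/negP => /asboolP.
  move=> a b c /asboolP Jb /asboolP Jc; apply/asboolP; exact: (sJ.2 a).
pose I : idealr R := HB.pack P (isIdealr.Build R P PC).
by exists I => a; split=> /asboolP.
Qed.

Lemma exists_prime_idealr (R : comNzRingType) (J : R -> Prop) : prime_ideal J ->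
  exists I : prime_idealr R, forall a, a \in I <-> J a.
Proof.
move=> [sJ nJ1 JM]; pose P : {pred R} := fun a => `[< J a >].
have PC : idealr_closed P.
  split; first exact/asboolP/sJ.1.
    by apply/negP => /asboolP.
  move=> a b c /asboolP Jb /asboolP Jc; apply/asboolP; exact: (sJ.2 a).
have PM : prime_idealr_closed P.
  by move=> a b /asboolP/JM[?|?]; apply/orP; [left|right]; apply/asboolP.
pose I : prime_idealr R := HB.pack P (isIdealr.Build R P PC)
  (isPrimeIdealrClosed.Build R P PM).
by exists I => a; split=> /asboolP.
Qed.

Lemma prime_ideal_idealr (R : comNzRingType) (p : prime_idealr R) :
  prime_ideal (fun a => a \in p).
Proof.
split; first exact: ideal_idealr.
  by rewrite idealr1.
by move=> a b; rewrite prime_idealrM => /orP.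
Qed.

Section LocalRing.
Variables (R : comNzRingType) (m : idealr R).
Hypothesis noR : noeth (R^o : lmodType R).
Hypothesis localR : local_ring m.

Lemma local_unit r : ~ r \in m -> exists r', 1 - r * r' \in m.
Proof.
move=> nmr; pose J := @sumS R (R^o : lmodType R) (gen [:: r]) (fun a =>
  a \in m).
have sr := @submodule_lspan R (R^o : lmodType R) [:: r].
have sm := ideal_idealr m.
have sJ : ideal J by exact: submodule_sum.
have [[_ [z [/lspan_consP[r' [_ [[? ->] ->]]] zm E]]]|nJ1] := pselect (J 1).
  exists r'; rewrite E big_ord0 addr0 /GRing.scale /= [r' * r]mulrC addrAC
    subrr.
  by rewrite add0r.
have [I IE] := exists_idealr sJ nJ1.
case: nmr; apply: (localR.1 I) => [a am|].
  by apply/IE; apply: sumSr.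
by apply/IE; apply: sumSl => //; apply/mem_lspan/mem_head.
Qed.

Lemma proper_sub_local (J : R -> Prop) : ideal J -> ~ J 1 -> forall a,
  J a -> a \in m.
Proof.
move=> sJ nJ1.
have [||K [sK JK nK1] Kmax] := @noeth_max _ _ (fun K : R^o -> Prop =>
  [/\ submodule K, forall a, J a -> K a & ~ K 1]) J noR;
    [by move=> ? []|by []|].
have [I IE] := exists_idealr sK nK1.
have Im : I =i m.
  apply: localR.2 => L IL a La; apply/IE.
  apply: (Kmax (fun a => a \in L)) La => [|b /IE/IL//].
  split; [exact: ideal_idealr|by move=> b /JK/IE/IL|by rewrite idealr1].
by move=> a /JK/IE; rewrite Im.
Qed.

Lemma local_prime : prime_ideal (fun a => a \in m).
Proof.
split; [exact: ideal_idealr|by rewrite idealr1|move=> a b abm].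
have [|nma] := pselect (a \in m); [by left|right].
have [r ra] := local_unit nma.
have -> : b = b * (1 - a * r) + r * (a * b).
  by rewrite mulrBr mulr1 [r * _]mulrCA [b * _]mulrCA [r * b]mulrC subrK.
by apply: rpredD; apply: idealMr.
Qed.

End LocalRing.

(** As [Q] contains [p], testing [Q] on [repr] does not depend on the representative. *)
Lemma lift_prime (R : comNzRingType) (p : prime_idealr R) (Q : R -> Prop) :
  prime_ideal Q -> (forall a, a \in p -> Q a) ->
  exists q : prime_idealr {ideal_quot p}, forall a,
    (\pi_({ideal_quot p}) a \in q) <-> Q a.
Proof.
move=> [sQ nQ1 QM] pQ.
have Qrepr a : Q (repr (\pi_({ideal_quot p}) a)) <-> Q a.
  have pa : repr (\pi_({ideal_quot p}) a) - a \in p.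
    by rewrite Quotient.idealrBE reprK.
  split=> Qa; first by rewrite -[a](subKr (repr (\pi_({ideal_quot p}) a)));
    apply: (submB sQ) => //; apply: pQ.
  by rewrite -[repr _](subrK a); apply: (submD sQ) => //; apply: pQ.
have pi_surj (x : {ideal_quot p}) : exists a, x = \pi_({ideal_quot p}) a.
  by exists (repr x); rewrite reprK.
have [|q qE] := @exists_prime_idealr {ideal_quot p} (fun x => Q (repr x));
  last first.
  by exists q => a; rewrite qE.
split; last 2 first.
- by rewrite -(rmorph1 (\pi_({ideal_quot p}))) => /Qrepr.
- move=> x y; have [a ->] := pi_surj x; have [b ->] := pi_surj y.
  by rewrite -(rmorphM (\pi_({ideal_quot p}))) !Qrepr; apply: QM.
split=> [|c x y].
  by rewrite -(raddf0 (\pi_({ideal_quot p}))); apply/Qrepr; apply: sQ.1.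
have [r ->] := pi_surj c; have [a ->] := pi_surj x; have [b ->] := pi_surj y.
rewrite /GRing.scale /= -(rmorphM (\pi_({ideal_quot p}))).
rewrite -(raddfD (\pi_({ideal_quot p}))) !Qrepr; exact: (sQ.2 r).
Qed.

(** * One-dimensional primes and symbolic powers *)

Section DimensionOne.
Variables (R : comNzRingType) (m : idealr R) (p : prime_idealr R).
Hypothesis noR : noeth (R^o : lmodType R).
Hypothesis localR : local_ring m.
Hypothesis dimRp : has_krull_dim {ideal_quot p} 1.

(** In a chain of length 1, lift an element of the upper prime outside the lower one: it is not in
    [p], and the upper prime contracts into [m]. *)
Lemma dim1_proper : exists2 s, s \in m & ~ s \in p.
Proof.
have [c /(_ 0%N isT)[_ c10]] := dimRp.1.
have /existsNP[x /not_implyP[c1x nc0x]] := c10.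
have [a xE] : exists a, x = \pi_({ideal_quot p}) a by exists (repr x);
  rewrite reprK.
exists a; last first.
  move=> pa; apply: nc0x; rewrite xE.
  have -> : \pi_({ideal_quot p}) a = 0; last exact: rpred0.
  rewrite -(raddf0 (\pi_({ideal_quot p}))); apply/eqP.
  by rewrite -Quotient.idealrBE subr0.
have [sQ nQ1 _] := prime_contraction
  (\pi_({ideal_quot p}) : {rmorphism R ->
    {ideal_quot p}}) (prime_ideal_idealr (c 1%N)).
by apply: (proper_sub_local noR localR sQ nQ1); rewrite xE in c1x.
Qed.

(** A prime strictly between [p] and [m] would give a chain of length 2 in [R/p]. *)
Lemma dim1_above Q : prime_ideal Q -> (forall a, a \in p -> Q a) ->
  (exists2 a, Q a & ~ a \in p) -> forall a, a \in m -> Q a.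
Proof.
move=> Qprime pQ [b Qb npb] a ma; apply: contrapT => nQa.
have [sQ nQ1 _] := Qprime.
have Qm := proper_sub_local noR localR sQ nQ1.
have [q0 q0E] := lift_prime (prime_ideal_idealr p) (fun a pa => pa).
have [q1 q1E] := lift_prime Qprime pQ.
have [q2 q2E] := lift_prime (local_prime localR) (fun a pa => Qm a (pQ a pa)).
have sub (P P' : R -> Prop) (q q' : prime_idealr {ideal_quot p}) :
    (forall a, (\pi_({ideal_quot p}) a \in q) <-> P a) ->
    (forall a, (\pi_({ideal_quot p}) a \in q') <-> P' a) ->
    (forall a, P a -> P' a) -> {subset q <= q'}.
  by move=> qE q'E PP' x; rewrite -[x]reprK => /qE/PP'/q'E.
suff /(dimRp.2 2%N) : prime_chain 2 (fun i => if i is i'.+1 then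
    if i' is _.+1 then q2 else q1 else q0) by [].
case=> [|[|]] // _; split; first exact: sub q0E q1E _.
- by move=> q10; apply: npb; apply/q0E/q10/q1E.
- exact: sub q1E q2E _.
by move=> q21; apply: nQa; apply/q1E/q21/q2E.
Qed.

End DimensionOne.

Section SymbolicPower.
Variables (R : comNzRingType) (N : lmodType R) (p : prime_idealr R).
Hypothesis fgN : fin_generated N.
Hypothesis pN : Supp N p.

Let quotE x : x \in imod N p <-> \pi_(quotmod (imod N p)) x = 0.
Proof.
have <- : \pi_(quotmod (imod N p)) 0 = 0.
  by apply: (addrI (\pi_(quotmod (imod N p)) 0)); rewrite -quotmod_piD !addr0.
by rewrite quotmod_piE subr0.
Qed.

Lemma Ass_quot_sub q : Ass (quotmod (imod N p)) q -> {subset p <= q}.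
Proof.
move=> [x xq] a ap; apply/xq; rewrite -[x]reprK.
rewrite [LHS]quotmod_piZ; apply/quotE/smulP.
exact: mem_iprod.
Qed.

(** If each [x] had a multiple by an element outside [p] lying in [pN], [annihilator_gen] would kill
    [N] by an element outside [p], against [Supp]. *)
Lemma Ass_quot : Ass (quotmod (imod N p)) p.
Proof.
have [es /generated_byP esP] := fgN.
have [x xP] : exists x : N, forall a, ~ a \in p -> ~ a *: x \in imod N p.
  apply: contrapT => /forallNP nx.
  have [_ np1 pM] := prime_ideal_idealr p.
  have [|||||a npa aN] := @annihilator_gen R N (fun a => ~ a \in p) (fun a =>
    a \in p) es.
  - exact: np1.
  - by move=> a b npa npb /pM[].
  - by move=> a b npa pb pab; apply: npa; rewrite -[a](subrK b) rpredD.
  - exact: ideal_idealr.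
  - move=> x _; have /existsNP[a /not_implyP[npa /contrapT/smulP ax]] := nx x.
    exists a => //; elim: ax => [|b y z bp _ _ IH]; first exact: iprod_nil.
    by apply: iprod_cons => //; apply/esP.
  have [[x b] /= _] := pN; apply; exists a => /=; first exact/negP.
  by rewrite scale1r scaler0 subr0; apply/aN/esP.
exists (\pi_(quotmod (imod N p)) x) => a.
rewrite [X in _ <-> X = 0]quotmod_piZ -quotE; split=> [ap|ax].
  by apply/smulP; apply: mem_iprod.
by apply: contrapT => /xP.
Qed.

(** [p] is associated to [N/pN] and contained in all its associated primes, so avoiding the minimal
    ones means avoiding [p]. *)
Lemma symbolic_powerP k x : symbolic_power N p k x <->
  saturated (fun a => a \in p) k x.
Proof.
split=> [[s sP /imod_idealXP sx]|[s nps sx]]; exists s => //.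
- apply/negP; apply: sP; split=> [|q Aq _]; first exact: Ass_quot.
  exact: Ass_quot_sub.
- by move=> q [Aq qmin]; apply/negP => /(qmin _ Ass_quot (Ass_quot_sub Aq)).
exact/imod_idealXP.
Qed.

End SymbolicPower.

Theorem theorem1p1 (R : comNzRingType) (m : idealr R) (N : lmodType R)
    (p : prime_idealr R)
    (noethR : noetherian_ring R) (localR : local_ring m)
    (fgN : fin_generated N) (N_neq0 : exists x : N, x != 0)
    (pN : Supp N p) (dimRp : has_krull_dim {ideal_quot p} 1) :
  adic_equiv_symbolic N p <->
  (forall z : prime_idealr (completion_ring m),
     Ass (completion_module m N) z ->
     exists q : prime_idealr (completion_ring m),
       [/\ Supp (completion_module m N) q,
           {subset z <= q} &
           forall a : R, (completion_map m a \in q) = (a \in p)]).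
Proof.
have noR := noetherian_noeth noethR.
have noN : noeth N.
  have [es /generated_byP esP] := fgN.
  by apply: (noeth_fg noR (s := es)) => x; apply/esP.
have [gm gmP] := noR _ (ideal_idealr m).
have [gp gpP] := noR _ (ideal_idealr p).
have p_prime := prime_ideal_idealr p; have [p_ideal np1 _] := p_prime.
have pm := proper_sub_local noR localR p_ideal np1.
have [s ms nps] := dim1_proper noR localR dimRp.
have [psi [G cN]] := completes_module m N; have cR := completes_ring m.
have m_max := local_unit localR.
have dim1 := dim1_above noR localR dimRp.
have equivE : adic_equiv_symbolic N p <-> forall n, exists k, forall x : N,
    saturated (fun a => a \in p) k x -> ipow (fun a => a \in p) n (fun=> True) x.
  split=> eqv n; have [k kP] := eqv n; exists k => x.
    by move/(symbolic_powerP fgN pN)/kP/imod_idealXP.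
  by move/(symbolic_powerP fgN pN)/kP/imod_idealXP.
split=> [/equivE eqv z [y yz]|contr]; last first.
  apply/equivE; apply: (equiv_of_contraction cR cN noR noN gmP gpP m_max p_prime dim1).
  move=> y yprime; have [z zE] := exists_prime_idealr yprime.
  have [|q [_ zq qp]] := contr z; first by exists y.
  exists (fun a => a \in q); split; first exact: prime_ideal_idealr.
    by move=> a /zE/zq.
  by move=> a; rewrite qp.
have zE : (fun a => is_true (a \in z)) = (fun a => a *: y = 0).
  by apply/funext => a; apply/propext; apply: yz.
have := prime_ideal_idealr z; rewrite zE => yprime.
have [Q [Qprime yQ Qp]] := contraction_of_equiv cR cN noR noN gmP gpP m_max
  p_prime pm ms nps dim1 eqv yprime.
have [q qE] := exists_prime_idealr Qprime; exists q; split.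
(* The fraction [y/1] survives in the localization because [q] contains the annihilator of [y]. *)
- exists (y, 1) => /=; first by rewrite idealr1.
  move=> [u /negP nqu /=]; rewrite scale1r scaler0 subr0 => /yQ/qE//.
- by move=> a /yz/yQ/qE.
by move=> a; apply/idP/idP => [/qE/Qp|/Qp/qE].
Qed.
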